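(* Let $\Lambda=kQ/I$ be a bound quiver algebra of infinite global dimension. If $\Lambda$ is a positive answer to Han's conjecture (resp. to Happel's question), then $\Lambda$ is of infinite + global dimension (resp. of infinite co+ global dimension).
   Context: Let $k$ be a field. $\otimes=\otimes_k$. Bound quiver algebra: $Q$ is a finite quiver with vertex set $Q_0$, $F$ is the ideal of $kQ$ generated by the arrows, $I$ is an admissible ideal ($F^m\subset I\subset F^2$ for some $m\ge 2$), and $\Lambda=kQ/I$. Paths are composed from right to left, so $y\Lambda x$ is spanned by the classes of paths from $x$ to $y$. For $x\in Q_0$, ${}_xk$ (resp. $k_x$) is the simple left (resp. right) $\Lambda$-module at $x$. A graded vector space $V_*$ is infinite if $V_n\neq 0$ for infinitely many $n$. An algebra of infinite global dimension is a positive answer to Happel's question (resp. Han's conjecture) if its Hochschild cohomology $\mathsf{HH}^*(\Lambda,\Lambda)=\mathrm{Ext}^*_{\Lambda\otimes\Lambda^{\mathrm{op}}}(\Lambda,\Lambda)$ (resp. its Hochschild homology $\mathsf{HH}_*(\Lambda,\Lambda)=\mathrm{Tor}_*^{\Lambda\otimes\Lambda^{\mathrm{op}}}(\Lambda,\Lambda)$) is infinite. $\Lambda$ has infinite + global dimension (resp. infinite co+ global dimension) if there is a pair of vertices $(y,x)$ with $y\Lambda x\neq 0$ and $\mathrm{Tor}^\Lambda_*(k_x,{}_yk)$ infinite (resp. $y\Lambda x\ne 0$ and $\mathrm{Tor}^\Lambda_*(k_y,{}_xk)$ infinite). *)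

(* Defs.v *)
From HB Require Import structures.
From mathcomp Require Import all_boot all_order all_algebra.
From mathcomp Require Import finmap.
From mathcomp.multinomials Require Import monalg.
From mathcomp Require Import boolp classical_sets functions cardinality.

Set Implicit Arguments.
Unset Strict Implicit.
Unset Printing Implicit Defensive.

Import GRing.Theory.
Local Open Scope ring_scope.
Local Open Scope classical_set_scope.
Local Open Scope quotient_scope.

HB.lock Definition msum (X : choiceType) (G V : zmodType) (F : X -> G -> V)
    (u : {malg G[X]}) : V :=
  \sum_(x <- msupp u) F x u@_x.

Section MSum.
Variables (X : choiceType) (G V : zmodType) (F : X -> G -> V).
Local Notation msum := (msum F).

Hypothesis FB : forall x, zmod_morphism (F x).

Let F0 x : F x 0 = 0. Proof. by rewrite -(subrr 0) FB subrr. Qed.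

Lemma msumEw (D : {fset X}) u : (msupp u `<=` D)%fset ->
  msum u = \sum_(x <- D) F x u@_x.
Proof.
move=> uD; rewrite unlock; apply: big_fset_incl => // x _ xu.
by rewrite mcoeff_outdom.
Qed.

Lemma msum_is_zmod_morphism : zmod_morphism msum.
Proof.
move=> u v; set D := (msupp u `|` msupp v)%fset.
rewrite (msumEw (msuppB_le u v)) (@msumEw D u) ?fsubsetUl //.
rewrite (@msumEw D v) ?fsubsetUr // -sumrB; apply: eq_bigr => x _.
by rewrite mcoeffB FB.
Qed.

Lemma msum0 : msum 0 = 0.
Proof. by have := msum_is_zmod_morphism 0 0; rewrite !subrr. Qed.

Lemma msumD u v : msum (u + v) = msum u + msum v.
Proof.
have mB := msum_is_zmod_morphism.
by rewrite -[v in LHS]opprK mB -[- v]sub0r mB msum0 sub0r opprK.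
Qed.

Lemma msumU x z : msum << z *g x >> = F x z.
Proof.
rewrite (msumEw msuppU_le) big_seq_fset1.
by rewrite mcoeffUU.
Qed.

End MSum.

Lemma malg_ind (X : choiceType) (G : zmodType) (P : {malg G[X]} -> Prop) :
  P 0 -> (forall u v, P u -> P v -> P (u + v)) ->
  (forall z x, P << z *g x >>) -> forall u, P u.
Proof. by move=> P0 PD PU u; rewrite [u]monalgE; elim/big_ind: _. Qed.

Section Gen.
Variables (V : zmodType) (G : set V).

Definition zgen : {pred V} := fun v =>
  `[< forall S : {pred V}, zmod_closed S -> (forall g, G g -> g \in S) ->
        v \in S >].

Lemma zgenP v : reflect (forall S : {pred V}, zmod_closed S ->
    (forall g, G g -> g \in S) -> v \in S) (v \in zgen).
Proof. exact: asboolP. Qed.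

Lemma zgen_closed : zmod_closed zgen.
Proof.
split; first by apply/zgenP => S [].
move=> u v /zgenP Su /zgenP Sv; apply/zgenP => S zS GS.
by have [_ SB] := zS; apply: SB; [exact: Su|exact: Sv].
Qed.

HB.instance Definition _ := GRing.isZmodClosed.Build V zgen zgen_closed.

Lemma mem_zgen g : G g -> g \in zgen.
Proof. by move=> Gg; apply/zgenP => S _; exact. Qed.

End Gen.

(* Right R-modules are left modules over the converse ring R^c. *)
Section Tensor.
Variables (R : pzRingType) (M : lmodType R^c) (N : lmodType R).

Inductive tensor_rel : set {malg int[(M * N)%type]} :=
| TensDl m m' n : tensor_rel (<<(m + m', n)>> - <<(m, n)>> - <<(m', n)>>)
| TensDr m n n' : tensor_rel (<<(m, n + n')>> - <<(m, n)>> - <<(m, n')>>)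
| TensZ (r : R) m n :
    tensor_rel (<<((r : R^c) *: m, n)>> - <<(m, r *: n)>>).

Definition tensor : Type := Quotient.quot (zgen tensor_rel).
HB.instance Definition _ := GRing.Zmodule.on tensor.

Definition tens (m : M) (n : N) : tensor :=
  \pi_(Quotient.quot (zgen tensor_rel)) <<(m, n)>>.

Let piE (u v : {malg int[(M * N)%type]}) : u - v \in zgen tensor_rel ->
  \pi_(Quotient.quot (zgen tensor_rel)) u =
  \pi_(Quotient.quot (zgen tensor_rel)) v.
Proof. by rewrite Quotient.idealrBE => /eqP. Qed.

Lemma tensDl m m' n : tens (m + m') n = tens m n + tens m' n.
Proof.
rewrite /tens -[RHS]raddfD; apply: piE.
by rewrite opprD addrA; apply: mem_zgen; exact: TensDl.
Qed.

Lemma tensDr m n n' : tens m (n + n') = tens m n + tens m n'.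
Proof.
rewrite /tens -[RHS]raddfD; apply: piE.
by rewrite opprD addrA; apply: mem_zgen; exact: TensDr.
Qed.

Lemma tensZ (r : R) m n : tens ((r : R^c) *: m) n = tens m (r *: n).
Proof. by apply: piE; apply: mem_zgen; exact: TensZ. Qed.

Lemma tensor_ind (P : tensor -> Prop) :
  P 0 -> (forall t t', P t -> P t' -> P (t - t')) ->
  (forall m n, P (tens m n)) -> forall t, P t.
Proof.
move=> P0 PB Pt t; rewrite -[t]reprK.
have PN s : P s -> P (- s) by move=> Ps; rewrite -sub0r; exact: PB.
have PD s s' : P s -> P s' -> P (s + s').
  by move=> Ps Ps'; rewrite -[s']opprK; apply: PB => //; exact: PN.
elim/malg_ind: (repr t) => [|u v Pu Pv|z [m n]].
- by rewrite raddf0.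
- by rewrite raddfD; exact: PD.
- have PM k : P (tens m n *+ k).
    by elim: k => [|k IH]; rewrite ?mulr0n ?mulrS //; exact: PD.
  have -> : << z *g (m, n) >> = <<(m, n)>> *~ z :> {malg int[(M * N)%type]}.
    by rewrite -[in LHS](intz z) (raddfMz (mkmalgU (m, n))).
  rewrite raddfMz; case: z => k; first exact: PM.
  by apply: PN; exact: PM.
Qed.

(* The map tens m n |-> f m n; additive as soon as f is balanced. *)
Definition tlift (V : zmodType) (f : M -> N -> V) (t : tensor) : V :=
  msum (fun x (z : int) => f x.1 x.2 *~ z)
    (repr (t : Quotient.quot (zgen tensor_rel))).

Record balanced (V : zmodType) (f : M -> N -> V) : Prop := Balanced {
  balDl : forall n, {morph f^~ n : m m' / m + m'};
  balDr : forall m, {morph f m : n n' / n + n'};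
  balZ : forall (r : R) m n, f ((r : R^c) *: m) n = f m (r *: n) }.

Section Lift.
Variables (V : zmodType) (f : M -> N -> V) (fb : balanced f).

Let F := fun x (z : int) => f x.1 x.2 *~ z.
Let FB x : zmod_morphism (F x).
Proof. by move=> a b; rewrite /F mulrzBr. Qed.

Let msum_rel u : u \in zgen tensor_rel -> msum F u = 0.
Proof.
pose S : {pred {malg int[(M * N)%type]}} := fun u => msum F u == 0.
have mB := msum_is_zmod_morphism FB.
have zS : zmod_closed S.
  split; rewrite /S /in_mem /=.
    by rewrite (msum0 FB).
  by move=> u' v /eqP u0 /eqP v0; rewrite /in_mem /= mB u0 v0 subrr.
move=> /zgenP /(_ S zS) uS; apply/eqP; apply: uS => g gr.
rewrite /S /in_mem /=.
case: gr => [m m' n|m n n'|r m n]; rewrite !mB !(msumU FB) /F /= !mulr1z.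
- by rewrite (balDl fb) -addrA -opprD subrr.
- by rewrite (balDr fb) -addrA -opprD subrr.
- by rewrite (balZ fb) subrr.
Qed.

Let tlift_pi u :
  tlift f (\pi_(Quotient.quot (zgen tensor_rel)) u : tensor) = msum F u.
Proof.
apply/eqP; rewrite -subr_eq0 -(msum_is_zmod_morphism FB); apply/eqP.
by apply: msum_rel; rewrite Quotient.idealrBE reprK.
Qed.

Lemma tlift_is_zmod_morphism : zmod_morphism (tlift f).
Proof.
move=> t t'; rewrite -[t]reprK -[t']reprK -raddfB !tlift_pi.
exact: msum_is_zmod_morphism.
Qed.

Lemma tliftE m n : tlift f (tens m n) = f m n.
Proof. by rewrite tlift_pi (msumU FB) /F mulr1z. Qed.

End Lift.
End Tensor.

Section TensorMap.
Variables (R : pzRingType) (M : lmodType R^c) (N N' : lmodType R).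
Variable f : {linear N -> N'}.

Definition tmap : tensor M N -> tensor M N' := tlift (fun m n => tens m (f n)).

Lemma tmap_balanced : balanced (fun m n => tens m (f n) : tensor M N').
Proof.
split=> [n m m'|m n n'|r m n].
- exact: tensDl.
- by rewrite raddfD tensDr.
- by rewrite linearZ tensZ.
Qed.

Lemma tmapE m n : tmap (tens m n) = tens m (f n).
Proof. exact: tliftE tmap_balanced _ _. Qed.

HB.instance Definition _ := GRing.isZmodMorphism.Build _ _ tmap
  (tlift_is_zmod_morphism tmap_balanced).

End TensorMap.
Arguments tmap {R} M {N N'} f _.

Section Hom.
Variables (R : pzRingType) (M N : lmodType R).

Definition linear_pred : {pred M -> N} := fun f => `[< linear f >].

Lemma linear_pred_closed : zmod_closed linear_pred.
Proof.
split; first by apply/asboolP => a u v; rewrite /= scaler0 addr0.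
move=> f g /asboolP lf /asboolP lg; apply/asboolP => a u v.
rewrite !fctE lf lg scalerBr opprD !addrA; congr (_ - _).
by rewrite addrAC.
Qed.

HB.instance Definition _ :=
  GRing.isZmodClosed.Build (M -> N) linear_pred linear_pred_closed.

Record hom := Hom { hom_val :> M -> N; homP : hom_val \in linear_pred }.
HB.instance Definition _ := [isSub for hom_val].
HB.instance Definition _ := [Choice of hom by <:].
HB.instance Definition _ := [SubChoice_isSubZmodule of hom by <:].

End Hom.

Section HomMap.
Variables (R : pzRingType) (M M' N : lmodType R) (d : {linear M' -> M}).

Lemma homcomp_subproof (f : hom M N) : (f \o d) \in @linear_pred R M' N.
Proof.
have /asboolP lf := homP f.
by apply/asboolP => a u v; rewrite /= linearP lf.
Qed.

Definition homcomp (f : hom M N) : hom M' N := Hom (homcomp_subproof f).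

Lemma homcomp_is_zmod_morphism : zmod_morphism homcomp.
Proof. by move=> f g; apply: val_inj. Qed.

HB.instance Definition _ := GRing.isZmodMorphism.Build _ _ homcomp
  homcomp_is_zmod_morphism.

End HomMap.
Arguments homcomp {R M M'} N d _.

Section Homology.
Variables (A B C : zmodType) (f : {additive A -> B}) (g : {additive B -> C}).

Definition cycle_pred : {pred B} := fun b => g b == 0.

Lemma cycle_closed : zmod_closed cycle_pred.
Proof.
split; first by rewrite /in_mem /= /cycle_pred raddf0.
move=> u v /eqP gu /eqP gv.
by rewrite /in_mem /= /cycle_pred raddfB gu gv subrr.
Qed.

HB.instance Definition _ := GRing.isZmodClosed.Build B cycle_pred cycle_closed.

Record cycles := Cycle { cycle_val : B; cycleP : cycle_val \in cycle_pred }.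
HB.instance Definition _ := [isSub for cycle_val].
HB.instance Definition _ := [Choice of cycles by <:].
HB.instance Definition _ := [SubChoice_isSubZmodule of cycles by <:].

Definition boundary_pred : {pred cycles} :=
  fun z => `[< exists a, f a = cycle_val z >].

Lemma boundary_closed : zmod_closed boundary_pred.
Proof.
split; first by apply/asboolP; exists 0; rewrite raddf0.
move=> u v /asboolP[a fa] /asboolP[b fb]; apply/asboolP; exists (a - b).
by rewrite raddfB fa fb.
Qed.

HB.instance Definition _ :=
  GRing.isZmodClosed.Build cycles boundary_pred boundary_closed.

Definition homology : Type := Quotient.quot boundary_pred.
HB.instance Definition _ := GRing.Zmodule.on homology.

End Homology.

Section KerMod.
Variables (R : pzRingType) (M N : lmodType R) (f : {linear M -> N}).

Definition ker_pred : {pred M} := fun m => f m == 0.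

Lemma ker_closed : subsemimod_closed ker_pred.
Proof.
split; first split.
- by rewrite /in_mem /= /ker_pred raddf0.
- move=> u v /eqP fu /eqP fv.
  by rewrite /in_mem /= /ker_pred raddfD /= fu fv addr0.
- by move=> a u /eqP fu; rewrite /in_mem /= /ker_pred linearZ /= fu scaler0.
Qed.

Lemma ker_zmod_closed : zmod_closed ker_pred.
Proof.
split; first by rewrite /in_mem /= /ker_pred raddf0.
move=> u v /eqP fu /eqP fv.
by rewrite /in_mem /= /ker_pred raddfB /= fu fv subrr.
Qed.

HB.instance Definition _ := GRing.isZmodClosed.Build M ker_pred ker_zmod_closed.

Record kermod := KerMod { kermod_val : M; kermodP : kermod_val \in ker_pred }.
HB.instance Definition _ := [isSub for kermod_val].
HB.instance Definition _ := [Choice of kermod by <:].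
HB.instance Definition _ := [SubChoice_isSubZmodule of kermod by <:].
HB.instance Definition _ :=
  GRing.SubZmodule_isSubLmodule.Build R M ker_pred kermod ker_closed.

End KerMod.

Section FreeMod.
Variables (R : pzRingType) (X : choiceType).

Definition freemod : Type := {malg R[X]}.
HB.instance Definition _ := GRing.Zmodule.on freemod.

Definition freescale (c : R) (u : freemod) : freemod :=
  [malg x in msupp (u : {malg R[X]}) => c * (u : {malg R[X]})@_x].

Lemma freescaleE c (u : freemod) x :
  (freescale c u : {malg R[X]})@_x = c * (u : {malg R[X]})@_x.
Proof. by rewrite mcoeffE; case: msuppP; rewrite ?mulr0. Qed.

Lemma freescaleA a b u : freescale a (freescale b u) = freescale (a * b) u.
Proof. by apply/malgP => x; rewrite !freescaleE mulrA. Qed.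

Lemma freescale1 : left_id 1 freescale.
Proof. by move=> u; apply/malgP => x; rewrite freescaleE mul1r. Qed.

Lemma freescaleDr : right_distributive freescale +%R.
Proof.
by move=> a u v; apply/malgP => x; rewrite !(freescaleE, mcoeffD) mulrDr.
Qed.

Lemma freescaleDl u : {morph freescale^~ u : a b / a + b}.
Proof.
by move=> a b; apply/malgP => x; rewrite !(freescaleE, mcoeffD) mulrDl.
Qed.

HB.instance Definition _ := GRing.Zmodule_isLmodule.Build R freemod
  freescaleA freescale1 freescaleDr freescaleDl.

Lemma freescaleU (c d : R) (x : X) :
  c *: (<< d *g x >> : freemod) = << c * d *g x >>.
Proof.
apply/malgP => y; rewrite freescaleE !mcoeffU.
by case: eqP; rewrite ?mulr0.
Qed.

Definition fgen (x : X) : freemod := << x >>.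

Section Lift.
Variables (M : lmodType R) (h : X -> M).

Let F := fun x (c : R) => c *: h x.
Let FB x : zmod_morphism (F x).
Proof. by move=> a b; rewrite /F scalerBl. Qed.

Definition flift (u : freemod) : M := msum F u.

Lemma flift_is_linear : linear flift.
Proof.
move=> a u v; rewrite [LHS](msumD FB); congr (_ + _).
rewrite /flift (@msumEw _ _ _ _ FB (msupp (u : {malg R[X]}))).
  rewrite [in RHS](msumEw FB (fsubset_refl _)) [RHS]scaler_sumr.
  apply: eq_bigr => x _.
  by rewrite /F scalerA; congr (_ *: _); exact: freescaleE.
apply/fsubsetP => x; rewrite -!mcoeff_neq0 -/(freescale a u) freescaleE.
by apply: contraNN => /eqP ->; rewrite mulr0.
Qed.

HB.instance Definition _ := GRing.isLinear.Build _ _ _ _ flift flift_is_linear.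

Lemma fliftE x : flift (fgen x) = h x.
Proof. by rewrite /flift (msumU FB) /F scale1r. Qed.

End Lift.

Lemma freemod_ext (M : lmodType R) (f g : {linear freemod -> M}) :
  (forall x, f (fgen x) = g (fgen x)) -> f =1 g.
Proof.
move=> fg u; elim/malg_ind: u => [|u v fu fv|z x].
- by rewrite (raddf0 f) (raddf0 g).
- by rewrite (raddfD f) (raddfD g); congr (_ + _); [exact: fu|exact: fv].
- have -> : (<< z *g x >> : freemod) = z *: fgen x.
    by rewrite freescaleU mulr1.
  by rewrite !linearZ /= fg.
Qed.

End FreeMod.

Section Projective.
Variable R : pzRingType.

Definition projective (P : lmodType R) : Prop :=
  forall (A B : lmodType R) (p : {linear A -> B}) (f : {linear P -> B}),
    (forall b, exists a, p a = b) ->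
    exists g : {linear P -> A}, forall x, p (g x) = f x.

Record resolution (M : lmodType R) := Resolution {
  res_mod : nat -> lmodType R;
  res_d : forall n, {linear res_mod n.+1 -> res_mod n};
  res_aug : {linear res_mod 0 -> M};
  res_proj : forall n, projective (res_mod n);
  res_surj : forall m, exists x, res_aug x = m;
  res_exact0 : forall x, res_aug x = 0 <-> exists y, res_d 0 y = x;
  res_exactS : forall n x,
    res_d n x = 0 <-> exists y, res_d n.+1 y = x }.

Definition pdim_le (M : lmodType R) (n : nat) : Prop :=
  exists P : resolution M, forall m, (n < m)%N -> forall x : res_mod P m, x = 0.

Definition infinite_gldim : Prop :=
  forall n, exists M : lmodType R, ~ pdim_le M n.

(* The standard free resolution: cover a module by the free module on its
   underlying set, then iterate on the kernel. *)
Definition fcover (M : lmodType R) : {linear freemod R M -> M} := flift id.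

Fixpoint syzygy (M : lmodType R) (n : nat) : lmodType R :=
  if n is n'.+1 then kermod (fcover (syzygy M n')) else M.

Definition std_mod (M : lmodType R) (n : nat) : lmodType R :=
  freemod R (syzygy M n).

Definition std_d (M : lmodType R) (n : nat) :
    {linear std_mod M n.+1 -> std_mod M n} :=
  (val : kermod (fcover (syzygy M n)) -> _) \o fcover (syzygy M n.+1).

Lemma free_projective (X : choiceType) : projective (freemod R X).
Proof.
move=> A B p f ps; pose h x := sval (cid (ps (f (fgen R x)))).
exists (flift h) => u.
apply: (@freemod_ext _ _ _ (p \o flift h) f) => x /=.
by rewrite fliftE /h; case: cid.
Qed.

Lemma fcover_surj (M : lmodType R) m : exists x, fcover M x = m.
Proof. by exists (fgen R m); exact: fliftE. Qed.

Lemma std_exact0 (M : lmodType R) (x : std_mod M 0) :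
  fcover M x = 0 <-> exists y, std_d M 0 y = x.
Proof.
split=> [/eqP x0|[y <-]].
  have [y yx] := fcover_surj (KerMod x0 : syzygy M 1).
  by exists y; rewrite /std_d /= yx.
exact/eqP/kermodP.
Qed.

Lemma std_exactS (M : lmodType R) n (x : std_mod M n.+1) :
  std_d M n x = 0 <-> exists y, std_d M n.+1 y = x.
Proof.
split=> [x0|[y <-]]; last first.
  rewrite /std_d /=.
  have /eqP -> := kermodP
    (fcover (syzygy M n.+2) y : kermod (fcover (syzygy M n.+1))).
  exact: (raddf0 (val : kermod (fcover (syzygy M n)) -> _)).
have {}x0 : x \in ker_pred (fcover (syzygy M n.+1)).
  by apply/eqP; apply: val_inj; exact: x0.
have [y yx] := fcover_surj (KerMod x0 : syzygy M n.+2).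
by exists y; rewrite /std_d /= yx.
Qed.

Definition std_res (M : lmodType R) : resolution M :=
  Resolution (fun n => @free_projective (syzygy M n)) (@fcover_surj M)
    (@std_exact0 M) (@std_exactS M).

End Projective.

Section TorExt.
Variable R : pzRingType.

Definition Tor_res (M : lmodType R^c) (N : lmodType R) (P : resolution N)
    (n : nat) : zmodType :=
  if n is n'.+1 then
    homology (tmap M (res_d P n'.+1)) (tmap M (res_d P n'))
  else homology (tmap M (res_d P 0))
         (\0 : tensor M (res_mod P 0) -> tensor M (res_mod P 0)).

Definition Tor (n : nat) (M : lmodType R^c) (N : lmodType R) : zmodType :=
  Tor_res M (std_res N) n.

Definition Ext_res (M : lmodType R) (P : resolution M) (N : lmodType R)
    (n : nat) : zmodType :=
  if n is n'.+1 then
    homology (homcomp N (res_d P n')) (homcomp N (res_d P n'.+1))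
  else homology (\0 : hom (res_mod P 0) N -> hom (res_mod P 0) N)
         (homcomp N (res_d P 0)).

Definition Ext (n : nat) (M N : lmodType R) : zmodType :=
  Ext_res (std_res M) N n.

End TorExt.

Definition graded_infinite (V : nat -> zmodType) : Prop :=
  infinite_set [set n | exists v : V n, v != 0].

(* MathComp's algType excludes the zero ring, which is the path algebra of
   the empty quiver; here a k-algebra is a possibly zero ring with a central
   ring morphism from k. *)
HB.mixin Record isPzAlgebra (k : fieldType) A of GRing.PzRing A := {
  kscalar : k -> A;
  kscalarB : zmod_morphism kscalar;
  kscalarM : monoid_morphism kscalar;
  kscalarC : forall (c : k) (a : A), kscalar c * a = a * kscalar c }.

#[short(type="pzAlgType")]
HB.structure Definition PzAlgebra (k : fieldType) :=
  {A of isPzAlgebra k A & GRing.PzRing A}.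

Section KModule.
Variables (k : fieldType) (A : pzAlgType k).

Lemma kscalarD : {morph @kscalar k A : c d / c + d}.
Proof.
move=> c d; have B := @kscalarB k A; have z := B 0 0; rewrite !subrr in z.
by rewrite -[d in LHS]opprK B -[- d]sub0r B z sub0r opprK.
Qed.

(* The k-vector space underlying A, as a left and as a right k-module. *)
Definition lmod : Type := A.
Definition rmod : Type := A.
HB.instance Definition _ := GRing.Zmodule.on lmod.
HB.instance Definition _ := GRing.Zmodule.on rmod.

Definition lscale (c : k) (a : lmod) : lmod := kscalar c * (a : A).
Definition rscale (c : k^c) (a : rmod) : rmod := (a : A) * kscalar (c : k).

Lemma lscaleA c d a : lscale c (lscale d a) = lscale (c * d) a.
Proof. by rewrite /lscale (kscalarM (s := A)).2 mulrA. Qed.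

Lemma lscale1 : left_id 1 lscale.
Proof. by move=> a; rewrite /lscale (kscalarM (s := A)).1; exact: mul1r. Qed.

Lemma lscaleDr : right_distributive lscale +%R.
Proof. by move=> c a b; exact: mulrDr. Qed.

Lemma lscaleDl a : {morph lscale^~ a : c d / c + d}.
Proof. by move=> c d; rewrite /lscale kscalarD; exact: mulrDl. Qed.

HB.instance Definition _ := GRing.Zmodule_isLmodule.Build k lmod
  lscaleA lscale1 lscaleDr lscaleDl.

Lemma rscaleA c d a : rscale c (rscale d a) = rscale (c * d) a.
Proof.
by rewrite /rscale -mulrA -[X in _ = _ * kscalar X]/((d : k) * (c : k))
           (kscalarM (s := A)).2.
Qed.

Lemma rscale1 : left_id 1 rscale.
Proof. by move=> a; rewrite /rscale (kscalarM (s := A)).1; exact: mulr1. Qed.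

Lemma rscaleDr : right_distributive rscale +%R.
Proof. by move=> c a b; exact: mulrDl. Qed.

Lemma rscaleDl a : {morph rscale^~ a : c d / c + d}.
Proof. by move=> c d; rewrite /rscale kscalarD; exact: mulrDr. Qed.

HB.instance Definition _ := GRing.Zmodule_isLmodule.Build k^c rmod
  rscaleA rscale1 rscaleDr rscaleDl.

End KModule.

Section Enveloping.
Variables (k : fieldType) (A : pzAlgType k).

(* The algebra A (x) A^op: the opposite product is used on the second factor,
   so (a (x) b) (a' (x) b') = a a' (x) b' b. *)
Definition env : Type := tensor (rmod A) (lmod A).
HB.instance Definition _ := GRing.Zmodule.on env.

Definition envt (a b : A) : env := tens (a : rmod A) (b : lmod A).

Definition env_mul (s t : env) : env :=
  tlift (fun (a : rmod A) (b : lmod A) =>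
    tlift (fun (a' : rmod A) (b' : lmod A) =>
      envt ((a : A) * a') ((b' : A) * b)) t) s.

Definition env_one : env := envt 1 1.

Lemma envtDl a a' b : envt (a + a') b = envt a b + envt a' b.
Proof. exact: (tensDl (a : rmod A)). Qed.

Lemma envtDr a b b' : envt a (b + b') = envt a b + envt a b'.
Proof. exact: (tensDr (a : rmod A) (b : lmod A)). Qed.

Lemma envtZ (c : k) a b : envt (a * kscalar c) b = envt a (kscalar c * b).
Proof. exact: (tensZ c (a : rmod A)). Qed.

Lemma env_ind (P : env -> Prop) :
  P 0 -> (forall t t', P t -> P t' -> P (t - t')) ->
  (forall a b, P (envt a b)) -> forall t, P t.
Proof. exact: tensor_ind. Qed.

Let inner_balanced a b : balanced
  (fun (a' : rmod A) (b' : lmod A) => envt (a * (a' : A)) ((b' : A) * b)).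
Proof.
split=> [n m m'|m n n'|r m n].
- by rewrite mulrDr envtDl.
- by rewrite mulrDl envtDr.
- by rewrite mulrA envtZ mulrA.
Qed.

Let inner (a b : A) (t : env) : env :=
  tlift (fun (a' : rmod A) (b' : lmod A) =>
    envt (a * (a' : A)) ((b' : A) * b)) t.

Let innerB a b : zmod_morphism (inner a b).
Proof. exact: tlift_is_zmod_morphism (inner_balanced a b). Qed.

Let innerE a b a' b' : inner a b (envt a' b') = envt (a * a') (b' * b).
Proof. exact: (tliftE (inner_balanced a b)). Qed.

Let inner0 a b : inner a b 0 = 0.
Proof. by have := innerB a b 0 0; rewrite !subrr. Qed.

Let outer_balanced t : balanced (fun (a : rmod A) (b : lmod A) => inner a b t).
Proof.
split=> [n m m'|m n n'|r m n]; elim/env_ind: t => [|t t' ht ht'|a b].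
- by rewrite !inner0 addr0.
- by rewrite !innerB ht ht' opprD addrACA.
- by rewrite !innerE mulrDl envtDl.
- by rewrite !inner0 addr0.
- by rewrite !innerB ht ht' opprD addrACA.
- by rewrite !innerE mulrDr envtDr.
- by rewrite !inner0.
- by rewrite !innerB ht ht'.
- by rewrite !innerE -mulrA kscalarC mulrA envtZ mulrA kscalarC -mulrA.
Qed.

Lemma env_mulE a b a' b' :
  env_mul (envt a b) (envt a' b') = envt (a * a') (b' * b).
Proof. by rewrite [LHS](tliftE (outer_balanced _)) -/(inner _ _ _) innerE. Qed.

Lemma env_mulBl t : zmod_morphism (env_mul^~ t).
Proof. exact: tlift_is_zmod_morphism (outer_balanced t). Qed.

Lemma env_mulBr s : zmod_morphism (env_mul s).
Proof.
move=> t t'; elim/env_ind: s => [|s s' hs hs'|a b].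
- have z u : env_mul 0 u = 0 by have := env_mulBl u 0 0; rewrite !subrr.
  by rewrite !z subrr.
- by rewrite !env_mulBl hs hs' !opprD !opprK addrACA.
- by rewrite /env_mul !(tliftE (outer_balanced _)); exact: innerB.
Qed.

Lemma env_mul0l t : env_mul 0 t = 0.
Proof. by have := env_mulBl t 0 0; rewrite !subrr. Qed.

Lemma env_mul0r t : env_mul t 0 = 0.
Proof. by have := env_mulBr t 0 0; rewrite !subrr. Qed.

Lemma env_mulA : associative env_mul.
Proof.
move=> r s t; elim/env_ind: r => [|r r' h h'|a b].
- by rewrite !env_mul0l.
- by rewrite !env_mulBl h h'.
elim/env_ind: s => [|s s' h h'|a' b'].
- by rewrite env_mul0r env_mul0l env_mul0r.
- by rewrite env_mulBl !env_mulBr env_mulBl h h'.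
elim/env_ind: t => [|t t' h h'|a'' b''].
- by rewrite !env_mul0r.
- by rewrite !env_mulBr h h'.
by rewrite !env_mulE !mulrA.
Qed.

Lemma env_mul1 : left_id env_one env_mul.
Proof.
elim/env_ind => [|t t' h h'|a b]; first exact: env_mul0r.
- by rewrite env_mulBr h h'.
- by rewrite env_mulE mul1r mulr1.
Qed.

Lemma env_mulr1 : right_id env_one env_mul.
Proof.
elim/env_ind => [|t t' h h'|a b]; first exact: env_mul0l.
- by rewrite env_mulBl h h'.
- by rewrite env_mulE mul1r mulr1.
Qed.

Let zmorphD (U V : zmodType) (f : U -> V) :
  zmod_morphism f -> {morph f : x y / x + y}.
Proof.
move=> fB x y; have f0 : f 0 = 0 by have := fB 0 0; rewrite !subrr.
by rewrite -[y in LHS]opprK fB -[- y]sub0r fB f0 sub0r opprK.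
Qed.

Lemma env_mulDl : left_distributive env_mul +%R.
Proof. by move=> s s' t; exact: (zmorphD (env_mulBl t)). Qed.

Lemma env_mulDr : right_distributive env_mul +%R.
Proof. by move=> s t t'; exact: (zmorphD (env_mulBr s)). Qed.

HB.instance Definition _ := GRing.Zmodule_isPzRing.Build env
  env_mulA env_mul1 env_mulr1 env_mulDl env_mulDr.

Definition regl : Type := A.
Definition regr : Type := A.
HB.instance Definition _ := GRing.Zmodule.on regl.
HB.instance Definition _ := GRing.Zmodule.on regr.

(* (a (x) b) . m = a m b *)
Definition regl_scale (t : env) (m : regl) : regl :=
  tlift (fun (a : rmod A) (b : lmod A) => (a : A) * (m : A) * (b : A) : regl) t.

(* m . (a (x) b) = b m a *)
Definition regr_scale (t : env^c) (m : regr) : regr :=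
  tlift (fun (a : rmod A) (b : lmod A) => (b : A) * (m : A) * (a : A) : regr)
    (t : env).

Let regl_balanced (m : A) :
  balanced (fun (a : rmod A) (b : lmod A) => (a : A) * m * (b : A) : regl).
Proof.
split=> [n u v|u n n'|r u n].
- by rewrite !mulrDl.
- by rewrite mulrDr.
- change ((u : A) * kscalar r * m * n = (u : A) * m * (kscalar r * (n : A))).
  by rewrite mulrA -[_ * kscalar r * m]mulrA kscalarC mulrA.
Qed.

Let regr_balanced (m : A) :
  balanced (fun (a : rmod A) (b : lmod A) => (b : A) * m * (a : A) : regr).
Proof.
split=> [n u v|u n n'|r u n].
- by rewrite mulrDr.
- by rewrite !mulrDl.
- change ((n : A) * m * ((u : A) * kscalar r) = kscalar r * (n : A) * m * u).
  by rewrite -!mulrA kscalarC !mulrA.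
Qed.

Lemma regl_scaleE a b m : regl_scale (envt a b) m = a * (m : A) * b.
Proof. exact: (tliftE (regl_balanced m)). Qed.

Lemma regr_scaleE a b m : regr_scale (envt a b) m = b * (m : A) * a.
Proof. exact: (tliftE (regr_balanced m)). Qed.

Let regl_scaleBl m : zmod_morphism (regl_scale^~ m).
Proof. exact: tlift_is_zmod_morphism (regl_balanced m). Qed.

Let regr_scaleBl m : zmod_morphism (regr_scale^~ m : env -> regr).
Proof. exact: tlift_is_zmod_morphism (regr_balanced m). Qed.

Let regl_scale0 m : regl_scale 0 m = 0.
Proof. by have := regl_scaleBl m 0 0; rewrite !subrr. Qed.

Let regr_scale0 m : regr_scale (0 : env) m = 0.
Proof. by have := regr_scaleBl m 0 0; rewrite !subrr. Qed.

Let regl_scaleBr t : zmod_morphism (regl_scale t).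
Proof.
move=> m m'; elim/env_ind: t => [|t t' h h'|a b].
- by rewrite !regl_scale0 subrr.
- by rewrite !regl_scaleBl h h' !opprD !opprK addrACA.
- by rewrite !regl_scaleE mulrBr mulrBl.
Qed.

Let regr_scaleBr (t : env) : zmod_morphism (regr_scale t).
Proof.
move=> m m'; elim/env_ind: t => [|t t' h h'|a b].
- by rewrite !regr_scale0 subrr.
- by rewrite !regr_scaleBl h h' !opprD !opprK addrACA.
- by rewrite !regr_scaleE mulrBr mulrBl.
Qed.

Lemma regl_scaleA s t m : regl_scale s (regl_scale t m) = regl_scale (s * t) m.
Proof.
elim/env_ind: s => [|s s' h h'|a b].
- by rewrite mul0r !regl_scale0.
- by rewrite mulrBl !regl_scaleBl h h'.
elim/env_ind: t => [|t t' h h'|a' b'].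
- have z : regl_scale (envt a b) 0 = 0.
    by have := regl_scaleBr (envt a b) 0 0; rewrite !subrr.
  by rewrite mulr0 !regl_scale0 z.
- by rewrite mulrBr !regl_scaleBl regl_scaleBr h h'.
by rewrite [_ * _]env_mulE !regl_scaleE !mulrA.
Qed.

Lemma regr_scaleA s t m : regr_scale s (regr_scale t m) = regr_scale (s * t) m.
Proof.
change (regr_scale s (regr_scale t m) = regr_scale ((t : env) * (s : env)) m).
move: s t; change (forall s t : env,
  regr_scale s (regr_scale t m) = regr_scale (t * s) m) => s t.
elim/env_ind: s => [|s s' h h'|a b].
- by rewrite mulr0 !regr_scale0.
- by rewrite mulrBr !regr_scaleBl h h'.
elim/env_ind: t => [|t t' h h'|a' b'].
- have z : regr_scale (envt a b) 0 = 0.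
    by have := regr_scaleBr (envt a b) 0 0; rewrite !subrr.
  by rewrite mul0r !regr_scale0 z.
- by rewrite mulrBl !regr_scaleBl regr_scaleBr h h'.
by rewrite [_ * _]env_mulE !regr_scaleE !mulrA.
Qed.

Lemma regl_scale1 : left_id 1 regl_scale.
Proof. by move=> m; rewrite regl_scaleE mul1r mulr1. Qed.

Lemma regr_scale1 : left_id 1 regr_scale.
Proof. by move=> m; rewrite [LHS]regr_scaleE mul1r mulr1. Qed.

Lemma regl_scaleDr : right_distributive regl_scale +%R.
Proof. by move=> t; exact: (zmorphD (regl_scaleBr t)). Qed.

Lemma regr_scaleDr : right_distributive regr_scale +%R.
Proof. by move=> t; exact: (zmorphD (regr_scaleBr t)). Qed.

Lemma regl_scaleDl m : {morph regl_scale^~ m : s t / s + t}.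
Proof. exact: (zmorphD (regl_scaleBl m)). Qed.

Lemma regr_scaleDl m : {morph regr_scale^~ m : s t / s + t}.
Proof. exact: (zmorphD (regr_scaleBl m)). Qed.

HB.instance Definition _ := GRing.Zmodule_isLmodule.Build env regl
  regl_scaleA regl_scale1 regl_scaleDr regl_scaleDl.
HB.instance Definition _ := GRing.Zmodule_isLmodule.Build env^c regr
  regr_scaleA regr_scale1 regr_scaleDr regr_scaleDl.

Definition HH_homology (n : nat) : zmodType := Tor n regr regl.
Definition HH_cohomology (n : nat) : zmodType := Ext n regl regl.

Definition positive_answer_Han : Prop :=
  infinite_gldim A /\ graded_infinite HH_homology.

Definition positive_answer_Happel : Prop :=
  infinite_gldim A /\ graded_infinite HH_cohomology.

End Enveloping.

Section Ideals.
Variable A : pzRingType.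

Definition two_sided (I : set A) : Prop :=
  [/\ I 0, forall a b, I a -> I b -> I (a - b)
    & forall a b, I b -> I (a * b) /\ I (b * a)].

Definition ideal_gen (G : set A) : set A :=
  [set a | forall J, two_sided J -> G `<=` J -> J a].

Definition ideal_mul (I J : set A) : set A :=
  [set a | a \in zgen [set x * y | x in I & y in J]].

Fixpoint ideal_exp (I : set A) (n : nat) : set A :=
  if n is n'.+1 then ideal_mul I (ideal_exp I n') else setT.

Record ideal := Ideal { ideal_set :> set A; idealP : two_sided ideal_set }.

Definition ideal_pred (I : ideal) : {pred A} := fun a => `[< ideal_set I a >].

Lemma ideal_pred_closed (I : ideal) : zmod_closed (ideal_pred I).
Proof.
have [I0 IB _] := idealP I; split; first exact/asboolP.
by move=> u v /asboolP Iu /asboolP Iv; apply/asboolP; exact: IB.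
Qed.

HB.instance Definition _ (I : ideal) :=
  GRing.isZmodClosed.Build A (ideal_pred I) (ideal_pred_closed I).

Variable I : ideal.

Definition quotalg : Type := Quotient.quot (ideal_pred I).
HB.instance Definition _ := GRing.Zmodule.on quotalg.

Definition quot_pi (a : A) : quotalg := \pi_(Quotient.quot (ideal_pred I)) a.
Definition quot_repr (x : quotalg) : A :=
  repr (x : Quotient.quot (ideal_pred I)).

Lemma quot_reprK : cancel quot_repr quot_pi.
Proof. exact: reprK. Qed.

Lemma quot_piP a b : quot_pi a = quot_pi b <-> ideal_set I (a - b).
Proof.
split=> [/eqP|Iab]; first by rewrite -Quotient.idealrBE => /asboolP.
by apply/eqP; rewrite -Quotient.idealrBE; apply/asboolP.
Qed.

Lemma quot_pi_is_zmod_morphism : zmod_morphism quot_pi.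
Proof.
exact: (raddfB (\pi_(Quotient.quot (ideal_pred I)) : {additive A -> _})).
Qed.

HB.instance Definition _ := GRing.isZmodMorphism.Build A quotalg quot_pi
  quot_pi_is_zmod_morphism.

Definition quot_mul (x y : quotalg) : quotalg :=
  quot_pi (quot_repr x * quot_repr y).

Lemma quot_mulE a b : quot_mul (quot_pi a) (quot_pi b) = quot_pi (a * b).
Proof.
have [_ IB IM] := idealP I; apply/quot_piP.
set a' := quot_repr _; set b' := quot_repr _.
have Ia : ideal_set I (a' - a) by apply/quot_piP; rewrite quot_reprK.
have Ib : ideal_set I (b - b') by apply/quot_piP; rewrite quot_reprK.
have -> : a' * b' - a * b = (a' - a) * b' - a * (b - b').
  by rewrite mulrBl mulrBr opprB addrA subrK.
by apply: IB; [exact: (IM _ _ Ia).2|exact: (IM _ _ Ib).1].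
Qed.

Lemma quot_ind (P : quotalg -> Prop) :
  (forall a, P (quot_pi a)) -> forall x, P x.
Proof. by move=> Pq x; rewrite -[x]quot_reprK. Qed.

Lemma quot_mulA : associative quot_mul.
Proof.
elim/quot_ind=> a; elim/quot_ind=> b; elim/quot_ind=> c.
by rewrite !quot_mulE mulrA.
Qed.

Lemma quot_mul1 : left_id (quot_pi 1) quot_mul.
Proof. by elim/quot_ind=> a; rewrite quot_mulE mul1r. Qed.

Lemma quot_mulr1 : right_id (quot_pi 1) quot_mul.
Proof. by elim/quot_ind=> a; rewrite quot_mulE mulr1. Qed.

Lemma quot_mulDl : left_distributive quot_mul +%R.
Proof.
elim/quot_ind=> a; elim/quot_ind=> b; elim/quot_ind=> c.
by rewrite -raddfD !quot_mulE -raddfD mulrDl.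
Qed.

Lemma quot_mulDr : right_distributive quot_mul +%R.
Proof.
elim/quot_ind=> a; elim/quot_ind=> b; elim/quot_ind=> c.
by rewrite -raddfD !quot_mulE -raddfD mulrDr.
Qed.

HB.instance Definition _ := GRing.Zmodule_isPzRing.Build quotalg
  quot_mulA quot_mul1 quot_mulr1 quot_mulDl quot_mulDr.

Lemma quot_piM a b : quot_pi (a * b) = quot_pi a * quot_pi b.
Proof. exact/esym/quot_mulE. Qed.

End Ideals.

Section QuotAlg.
Variables (k : fieldType) (A : pzAlgType k) (I : ideal A).

Definition quot_kscalar (c : k) : quotalg I := quot_pi I (kscalar c).

Lemma quot_kscalarB : zmod_morphism quot_kscalar.
Proof. by move=> c d; rewrite /quot_kscalar (kscalarB (s := A)) raddfB. Qed.

Lemma quot_kscalarM : monoid_morphism quot_kscalar.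
Proof.
have [K1 KM] := kscalarM (s := A).
by split=> [|c d]; rewrite /quot_kscalar ?K1 // KM quot_piM.
Qed.

Lemma quot_kscalarC c (x : quotalg I) :
  quot_kscalar c * x = x * quot_kscalar c.
Proof.
by elim/quot_ind: x => a; rewrite /quot_kscalar -!quot_piM kscalarC.
Qed.

HB.instance Definition _ := isPzAlgebra.Build k (quotalg I)
  quot_kscalarB quot_kscalarM quot_kscalarC.

End QuotAlg.

Record quiver := Quiver {
  vertex : finType; arrow : finType;
  src : arrow -> vertex; tgt : arrow -> vertex }.
Arguments src {q}.
Arguments tgt {q}.

Section Paths.
Variable Q : quiver.

Fixpoint is_path (x : vertex Q) (s : seq (arrow Q)) : bool :=
  if s is a :: s' then (src a == x) && is_path (tgt a) s' else true.

Definition path_end (x : vertex Q) (s : seq (arrow Q)) : vertex Q :=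
  last x [seq tgt a | a <- s].

(* A path is its starting vertex with its arrows, in order of traversal. *)
Record qpath := QPath {
  qpath_val : vertex Q * seq (arrow Q);
  qpathP : is_path qpath_val.1 qpath_val.2 }.
HB.instance Definition _ := [isSub for qpath_val].
HB.instance Definition _ := [Choice of qpath by <:].

Definition pstart (p : qpath) : vertex Q := (val p).1.
Definition parr (p : qpath) : seq (arrow Q) := (val p).2.
Definition pend (p : qpath) : vertex Q := path_end (pstart p) (parr p).

Definition triv (x : vertex Q) : qpath := @QPath (x, [::]) isT.

Lemma arrow_path_subproof (a : arrow Q) : is_path (src a) [:: a].
Proof. by rewrite /= eqxx. Qed.

Definition arrow_path (a : arrow Q) : qpath :=
  @QPath (src a, [:: a]) (arrow_path_subproof a).

Lemma is_path_cat x s t :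
  is_path x (s ++ t) = is_path x s && is_path (path_end x s) t.
Proof. by elim: s x => [|a s IH] x //=; rewrite IH andbA. Qed.

Lemma path_end_cat x s t :
  path_end x (s ++ t) = path_end (path_end x s) t.
Proof. by rewrite /path_end map_cat last_cat. Qed.

Lemma pcomp_subproof p q : pend q = pstart p ->
  is_path (pstart q) (parr q ++ parr p).
Proof.
by move=> e; rewrite is_path_cat -/(pend q) e; apply/andP; split;
  exact: qpathP.
Qed.

(* Composition from right to left: q is traversed first, then p. *)
Definition pcomp (p q : qpath) : option qpath :=
  if @eqP _ (pend q) (pstart p) is ReflectT e then
    Some (@QPath (pstart q, parr q ++ parr p) (pcomp_subproof e))
  else None.

Variant pcomp_spec (p q : qpath) : option qpath -> Prop :=
| PCompSome r of pend q = pstart p & val r = (pstart q, parr q ++ parr p) :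
    pcomp_spec p q (Some r)
| PCompNone of pend q <> pstart p : pcomp_spec p q None.

Lemma pcompP p q : pcomp_spec p q (pcomp p q).
Proof. by rewrite /pcomp; case: eqP => e; constructor. Qed.

Lemma pcompA p q r :
  obind (fun s => pcomp s r) (pcomp p q) = obind (pcomp p) (pcomp q r).
Proof.
case: (pcompP p q) => [s e vs|ne] /=; case: (pcompP q r) => [t e' vt|ne'] //=.
- have es : pstart s = pstart q by rewrite /pstart vs.
  have et : pend t = pend q.
    by rewrite /pend /pstart /parr vt /= path_end_cat -/(pend r) e'.
  case: pcompP => [u eu vu|[]]; last by rewrite es.
  case: pcompP => [w ew vw|[]]; last by rewrite et.
  congr Some; apply: val_inj; rewrite /= vu vw /parr vs vt /pstart vt /=.
  by rewrite catA.
- case: pcompP => // u eu; case: ne'.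
  by rewrite eu /pstart vs.
- case: pcompP => // u eu; case: ne.
  by rewrite -eu /pend /pstart /parr vt /= path_end_cat -/(pend r) e'.
Qed.

Lemma pcomp1p q : pcomp (triv (pend q)) q = Some q.
Proof.
case: pcompP => // r _ vr; congr Some; apply: val_inj; rewrite /= vr cats0.
by case: (q) => [[]].
Qed.

Lemma pcompp1 p : pcomp p (triv (pstart p)) = Some p.
Proof.
case: pcompP => // r _ vr; congr Some; apply: val_inj; rewrite /= vr /=.
by case: (p) => [[]].
Qed.

Lemma pcomp1_neq x q : pend q != x -> pcomp (triv x) q = None.
Proof. by case: pcompP => // r ->; rewrite eqxx. Qed.

Lemma pcompp1_neq x p : pstart p != x -> pcomp p (triv x) = None.
Proof. by case: pcompP => // r <-; rewrite eqxx. Qed.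

Lemma pcomp_triv x p q :
  (pcomp p q == Some (triv x)) = (p == triv x) && (q == triv x).
Proof.
apply/eqP/andP => [|[/eqP -> /eqP ->]]; last exact: (pcomp1p (triv x)).
case: pcompP => // r e vr [re]; move: vr; rewrite re /= => -[xq].
move=> /esym /eqP; rewrite -size_eq0 size_cat addn_eq0 !size_eq0.
move=> /andP[/eqP q0 /eqP p0].
have eta (o : qpath) : val o = (pstart o, parr o) by case: o => [[]].
split; apply/eqP/val_inj; rewrite eta.
  by rewrite p0 -e /pend q0 -xq.
by rewrite q0 -xq.
Qed.

End Paths.

Definition pathalg (k : fieldType) (Q : quiver) : Type := freemod k (qpath Q).
HB.instance Definition _ (k : fieldType) (Q : quiver) :=
  GRing.Lmodule.on (pathalg k Q).

HB.lock Definition pterm (k : fieldType) (Q : quiver) (c : k) (p : qpath Q) :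
    pathalg k Q :=
  << c *g p >>.

Section PathAlgebra.
Variables (k : fieldType) (Q : quiver).
Local Notation pathalg := (pathalg k Q).
Local Notation pterm := (@pterm k Q).

Definition oterm (c : k) (p : option (qpath Q)) : pathalg :=
  if p is Some r then pterm c r else 0.

Definition pterm_mul (a : k) (p : qpath Q) (v : pathalg) : pathalg :=
  msum (fun q b => oterm (a * b) (pcomp p q)) v.

Definition pa_mul (u v : pathalg) : pathalg :=
  msum (fun p a => pterm_mul a p v) u.

Definition pa_one : pathalg := \sum_(x : vertex Q) pterm 1 (triv x).

Lemma pa_ind (P : pathalg -> Prop) :
  P 0 -> (forall u v, P u -> P v -> P (u + v)) ->
  (forall c p, P (pterm c p)) -> forall u, P u.
Proof. by rewrite unlock; exact: malg_ind. Qed.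

Lemma otermB c d p : oterm (c - d) p = oterm c p - oterm d p.
Proof.
by case: p => [p|] /=; [rewrite unlock; exact: monalgUB|rewrite subr0].
Qed.

Let inB p a : forall q : qpath Q,
  zmod_morphism (fun b : k => oterm (a * b) (pcomp p q)).
Proof. by move=> q b b'; rewrite mulrBr otermB. Qed.

Lemma pterm_mul0 a p : pterm_mul a p 0 = 0.
Proof. exact: (msum0 (inB p a)). Qed.

Lemma pterm_mulD a p : {morph pterm_mul a p : u v / u + v}.
Proof. exact: (msumD (inB p a)). Qed.

Lemma pterm_mulU a p b q :
  pterm_mul a p (pterm b q) = oterm (a * b) (pcomp p q).
Proof. by rewrite unlock; exact: (msumU (inB p a)). Qed.

Let outB v : forall p : qpath Q, zmod_morphism (fun a : k => pterm_mul a p v).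
Proof.
move=> p a a'; elim/pa_ind: v => [|u v hu hv|c q].
- by rewrite !pterm_mul0 subrr.
- by rewrite !pterm_mulD hu hv opprD addrACA.
- by rewrite !pterm_mulU mulrBl otermB.
Qed.

Lemma pa_mulDl : left_distributive pa_mul +%R.
Proof. by move=> u u' v; exact: (msumD (outB v)). Qed.

Lemma pa_mul0l v : pa_mul 0 v = 0.
Proof. exact: (msum0 (outB v)). Qed.

Lemma pa_mulU a p v :
  pa_mul (pterm a p) v = pterm_mul a p v.
Proof. by rewrite unlock; exact: (msumU (outB v)). Qed.

Lemma pa_mulDr : right_distributive pa_mul +%R.
Proof.
move=> u v v'; elim/pa_ind: u => [|u u' h h'|a p].
- by rewrite !pa_mul0l addr0.
- by rewrite !pa_mulDl h h' addrACA.
- by rewrite !pa_mulU pterm_mulD.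
Qed.

Lemma pa_mul0r v : pa_mul v 0 = 0.
Proof.
by apply: (addrI (pa_mul v 0)); rewrite -pa_mulDr !addr0.
Qed.

Lemma pa_mulE a p b q :
  pa_mul (pterm a p) (pterm b q) = oterm (a * b) (pcomp p q).
Proof. by rewrite pa_mulU pterm_mulU. Qed.

Lemma pa_mulA : associative pa_mul.
Proof.
move=> u v w; elim/pa_ind: u => [|u u' h h'|a p].
- by rewrite !pa_mul0l.
- by rewrite !pa_mulDl h h'.
elim/pa_ind: v => [|v v' h h'|b q].
- by rewrite pa_mul0l pa_mul0r pa_mul0l.
- by rewrite !(pa_mulDl, pa_mulDr) h h'.
elim/pa_ind: w => [|w w' h h'|c r].
- by rewrite !pa_mul0r.
- by rewrite !pa_mulDr h h'.
have L d s o :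
    pa_mul (pterm d s) (oterm c o) = oterm (d * c) (obind (pcomp s) o).
  by case: o => [o|] /=; [exact: pa_mulE|exact: pa_mul0r].
rewrite !pa_mulE.
transitivity (oterm (a * (b * c)) (obind (pcomp p) (pcomp q r))).
  by case: (pcomp q r) => [o|] /=; [exact: pa_mulE|exact: pa_mul0r].
rewrite -pcompA mulrA.
by case: (pcomp p q) => [o|] /=; [rewrite pa_mulE|rewrite pa_mul0l].
Qed.

Lemma pa_mul1 : left_id pa_one pa_mul.
Proof.
have suml (I : finType) (F : I -> pathalg) v :
    pa_mul (\sum_i F i) v = \sum_i pa_mul (F i) v.
  apply: (big_morph (pa_mul^~ v)) => [u u'|]; first exact: pa_mulDl.
  exact: pa_mul0l.
elim/pa_ind => [|u u' h h'|c p]; first exact: pa_mul0r.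
- by rewrite pa_mulDr h h'.
rewrite suml (bigD1 (pend p)) //= big1 => [|x xp].
  by rewrite pa_mulE pcomp1p mul1r addr0.
by rewrite pa_mulE pcomp1_neq // eq_sym.
Qed.

Lemma pa_mulr1 : right_id pa_one pa_mul.
Proof.
have sumr (I : finType) (F : I -> pathalg) v :
    pa_mul v (\sum_i F i) = \sum_i pa_mul v (F i).
  apply: (big_morph (pa_mul v)) => [u u'|]; first exact: pa_mulDr.
  exact: pa_mul0r.
elim/pa_ind => [|u u' h h'|c p]; first exact: pa_mul0l.
- by rewrite pa_mulDl h h'.
rewrite sumr (bigD1 (pstart p)) //= big1 => [|x xp].
  by rewrite pa_mulE pcompp1 mulr1 addr0.
by rewrite pa_mulE pcompp1_neq // eq_sym.
Qed.

HB.instance Definition _ := GRing.Zmodule_isPzRing.Build pathalg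
  pa_mulA pa_mul1 pa_mulr1 pa_mulDl pa_mulDr.

Lemma ptermE a p b q :
  pterm a p * pterm b q = oterm (a * b) (pcomp p q).
Proof. exact: pa_mulE. Qed.

Lemma ptermZ c d p : c *: pterm d p = pterm (c * d) p.
Proof. by rewrite unlock; exact: freescaleU. Qed.

Lemma otermZ c d o : c *: oterm d o = oterm (c * d) o.
Proof. by case: o => [o|] /=; [exact: ptermZ|exact: scaler0]. Qed.

Lemma pa_scaleAl (c : k) (u v : pathalg) : c *: (u * v) = (c *: u) * v.
Proof.
elim/pa_ind: u => [|u u' h h'|a p].
- by rewrite mul0r scaler0 mul0r.
- by rewrite mulrDl !scalerDr mulrDl h h'.
elim/pa_ind: v => [|v v' h h'|b q].
- by rewrite !mulr0 scaler0.
- by rewrite !mulrDr scalerDr h h'.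
by rewrite ptermZ !ptermE otermZ mulrA.
Qed.

Lemma pa_scaleAr (c : k) (u v : pathalg) : c *: (u * v) = u * (c *: v).
Proof.
elim/pa_ind: u => [|u u' h h'|a p].
- by rewrite !mul0r scaler0.
- by rewrite !mulrDl scalerDr h h'.
elim/pa_ind: v => [|v v' h h'|b q].
- by rewrite !(mulr0, scaler0).
- by rewrite mulrDr !scalerDr mulrDr h h'.
by rewrite ptermZ !ptermE otermZ mulrCA.
Qed.

Definition pa_kscalar (c : k) : pathalg := c *: pa_one.

Lemma pa_kscalarB : zmod_morphism pa_kscalar.
Proof. by move=> c d; exact: scalerBl. Qed.

Lemma pa_kscalarM : monoid_morphism pa_kscalar.
Proof.
split=> [|c d]; first exact: scale1r.
by rewrite /pa_kscalar -pa_scaleAl mul1r scalerA.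
Qed.

Lemma pa_kscalarC c u : pa_kscalar c * u = u * pa_kscalar c.
Proof. by rewrite -pa_scaleAl -pa_scaleAr mul1r mulr1. Qed.

HB.instance Definition _ := isPzAlgebra.Build k pathalg
  pa_kscalarB pa_kscalarM pa_kscalarC.

Definition arrow_ideal : set pathalg :=
  ideal_gen (range (fun a : arrow Q => pterm 1 (arrow_path a))).

Definition admissible (I : set pathalg) : Prop :=
  exists2 m, (2 <= m)%N &
    ideal_exp arrow_ideal m `<=` I /\ I `<=` ideal_exp arrow_ideal 2.

Record admissible_ideal := AdmissibleIdeal {
  adm_ideal :> ideal pathalg; admP : admissible adm_ideal }.

Definition tcoef (x : vertex Q) (u : pathalg) : k :=
  mcoeff (triv x) (u : {malg k[qpath Q]}).

Lemma tcoefB x : zmod_morphism (tcoef x).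
Proof. exact: mcoeffB. Qed.

Lemma tcoefD x : {morph tcoef x : u v / u + v}.
Proof. exact: mcoeffD. Qed.

Lemma tcoef0 x : tcoef x 0 = 0.
Proof. exact: mcoeff0. Qed.

Lemma tcoefU x c p : tcoef x (pterm c p) = c *+ (p == triv x).
Proof. by rewrite unlock; exact: mcoeffU. Qed.

Lemma tcoef1 x : tcoef x 1 = 1.
Proof.
rewrite (big_morph (tcoef x) (@tcoefD x) (@tcoef0 x)) (bigD1 x) //= big1.
  by rewrite tcoefU eqxx addr0.
by move=> y yx; rewrite tcoefU -val_eqE /= xpair_eqE eqxx andbT (negbTE yx).
Qed.

Lemma tcoefM x : {morph tcoef x : u v / u * v}.
Proof.
move=> u v; elim/pa_ind: u => [|u u' h h'|a p].
- by rewrite mul0r tcoef0 mul0r.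
- by rewrite mulrDl !tcoefD mulrDl h h'.
elim/pa_ind: v => [|v v' h h'|b q].
- by rewrite mulr0 tcoef0 mulr0.
- by rewrite mulrDr !tcoefD mulrDr h h'.
rewrite ptermE !tcoefU.
have -> : tcoef x (oterm (a * b) (pcomp p q)) =
    (a * b) *+ (pcomp p q == Some (triv x)).
  by case: pcomp => [r|] /=; rewrite ?tcoef0 // tcoefU.
by rewrite pcomp_triv mulrnAl mulrnAr -mulrnA mulnC mulnb.
Qed.

Lemma arrow_ideal_tcoef x u : arrow_ideal u -> tcoef x u = 0.
Proof.
move=> /(_ [set v | tcoef x v = 0]); apply.
- split=> [|v w /= v0 w0|v w /= w0] /=; first exact: tcoef0.
  + by rewrite tcoefB v0 w0 subrr.
  + by rewrite !tcoefM w0 mulr0 mul0r.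
- by move=> _ [a _ <-] /=; rewrite tcoefU -val_eqE /= xpair_eqE andbF.
Qed.

Lemma adm_tcoef (I : admissible_ideal) x u : ideal_set I u -> tcoef x u = 0.
Proof.
have [m _ [_ IF]] := admP I.
move=> /IF /zgenP /(_ (fun v => tcoef x v == 0)) H; apply/eqP; apply: H.
  split=> [|v w]; rewrite /in_mem /= ?tcoef0 //.
  by move=> /eqP v0 /eqP w0; rewrite tcoefB v0 w0 subrr.
move=> _ [v Fv [w _ <-]]; rewrite /in_mem /=.
by rewrite tcoefM (arrow_ideal_tcoef x Fv) mul0r.
Qed.

End PathAlgebra.

Section BoundQuiverAlgebra.
Variables (k : fieldType) (Q : quiver) (I : admissible_ideal k Q).

Definition bqa : pzAlgType k := quotalg I.

Definition idem (x : vertex Q) : bqa := quot_pi I (pterm 1 (triv x)).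

Definition corner_neq0 (y x : vertex Q) : Prop :=
  exists l : bqa, idem y * l * idem x != 0.

(* The coefficient of the trivial path at x; it vanishes on I. *)
Definition chi (x : vertex Q) (l : bqa) : k := tcoef x (quot_repr l).

Lemma chiE x u : chi x (quot_pi I u) = tcoef x u.
Proof.
apply/eqP; rewrite -subr_eq0 -tcoefB; apply/eqP.
by apply: (adm_tcoef (I := I)); apply/quot_piP; exact: quot_reprK.
Qed.

Lemma chi1 x : chi x 1 = 1.
Proof. by rewrite [LHS]chiE tcoef1. Qed.

Lemma chiM x : {morph chi x : l m / l * m}.
Proof.
elim/quot_ind=> u; elim/quot_ind=> v.
by rewrite -[_ * _]quot_piM !chiE tcoefM.
Qed.

Lemma chiD x : {morph chi x : l m / l + m}.
Proof.
elim/quot_ind=> u; elim/quot_ind=> v.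
by rewrite -[quot_pi I u + _](raddfD (quot_pi I)) !chiE tcoefD.
Qed.

End BoundQuiverAlgebra.

(* The line k on which Lambda acts through chi x. *)
Definition simple_left (k : fieldType) (Q : quiver)
  (I : admissible_ideal k Q) (x : vertex Q) : Type := k.
Definition simple_right (k : fieldType) (Q : quiver)
  (I : admissible_ideal k Q) (x : vertex Q) : Type := k.
HB.instance Definition _ k Q (I : admissible_ideal k Q) x :=
  GRing.Zmodule.copy (simple_left I x) k.
HB.instance Definition _ k Q (I : admissible_ideal k Q) x :=
  GRing.Zmodule.copy (simple_right I x) k.

Section Simples.
Variables (k : fieldType) (Q : quiver) (I : admissible_ideal k Q).
Variable x : vertex Q.

Definition simple_left_scale (l : bqa I) (c : simple_left I x) :
  simple_left I x := chi x l * (c : k).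

Definition simple_right_scale (l : (bqa I)^c) (c : simple_right I x) :
  simple_right I x := (c : k) * chi x (l : bqa I).

Lemma simple_leftA l m c :
  simple_left_scale l (simple_left_scale m c) = simple_left_scale (l * m) c.
Proof. by rewrite /simple_left_scale chiM mulrA. Qed.

Lemma simple_left1 : left_id 1 simple_left_scale.
Proof. by move=> c; rewrite /simple_left_scale chi1; exact: mul1r. Qed.

Lemma simple_leftDr : right_distributive simple_left_scale +%R.
Proof. by move=> l c d; exact: mulrDr. Qed.

Lemma simple_leftDl c : {morph simple_left_scale^~ c : l m / l + m}.
Proof. by move=> l m; rewrite /simple_left_scale chiD; exact: mulrDl. Qed.

HB.instance Definition _ := GRing.Zmodule_isLmodule.Build (bqa I)
  (simple_left I x) simple_leftA simple_left1 simple_leftDr simple_leftDl.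

Lemma simple_rightA l m c :
  simple_right_scale l (simple_right_scale m c) = simple_right_scale (l * m) c.
Proof.
rewrite /simple_right_scale -[chi x (l * m)]/(chi x ((m : bqa I) * l)).
by rewrite chiM mulrA.
Qed.

Lemma simple_right1 : left_id 1 simple_right_scale.
Proof.
by move=> c; rewrite /simple_right_scale [chi x _]chi1; exact: mulr1.
Qed.

Lemma simple_rightDr : right_distributive simple_right_scale +%R.
Proof. by move=> l c d; exact: mulrDl. Qed.

Lemma simple_rightDl c : {morph simple_right_scale^~ c : l m / l + m}.
Proof.
move=> l m; rewrite /simple_right_scale [chi x (l + m)]chiD.
exact: mulrDr.
Qed.

HB.instance Definition _ := GRing.Zmodule_isLmodule.Build (bqa I)^c
  (simple_right I x) simple_rightA simple_right1 simple_rightDr simple_rightDl.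

End Simples.

Section PlusDimension.
Variables (k : fieldType) (Q : quiver) (I : admissible_ideal k Q).

Definition Tor_simple (x y : vertex Q) (n : nat) : zmodType :=
  Tor n (simple_right I x) (simple_left I y).

Definition infinite_plus_gldim : Prop :=
  exists y x : vertex Q,
    corner_neq0 I y x /\ graded_infinite (Tor_simple x y).

Definition infinite_coplus_gldim : Prop :=
  exists y x : vertex Q,
    corner_neq0 I y x /\ graded_infinite (Tor_simple y x).

End PlusDimension.

(* Main.v *)
Require Import Defs.
From HB Require Import structures.
From mathcomp Require Import all_boot all_order all_algebra.
From mathcomp Require Import finmap.
From mathcomp.multinomials Require Import monalg.
From mathcomp Require Import boolp classical_sets functions cardinality.

(** The Hochschild homology and cohomology of A = kQ/I are computed by a free
    resolution P of A over its enveloping algebra E, with coefficients in A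
    again. The point is to filter the coefficients.

    Since I contains all long paths, the classes of the paths, taken by
    decreasing length, filter the bimodule A. If p is a path from x to y, then
    multiplying p on either side by a path of positive length gives 0 or a longer
    path; so a (x) b acts on the subquotient of p by chi_y(a) chi_x(b), where
    chi_x is the character of A at the vertex x. The nonzero subquotients are
    thus the simple bimodules S(y,x) with left vertex y and right vertex x, for
    pairs such that e_y A e_x is nonzero ([pclass_triangular], [flag_filtered]).
    The long exact sequences of Tor and Ext, of which only the middle is used
    ([tensor_exact_middle], [coexact_middle]), show that HH_n vanishes as soon as
    Tor_n(S(y,x), A) does for all these pairs, and HH^n as soon as
    Ext^n(A, S(y,x)) does.

    It remains to go from E to A. As right modules, P and its syzygies are
    projective ([right_projective_syzygy]), so P splits, and tensoring it on the
    right with the simple module at a vertex v gives a free resolution of that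
    simple module ([rres]). Tensoring on the left with the simple module at u, and
    comparing with the standard resolution ([Tor_res_comparison]), one gets that
    Tor_n(k_u, _vk) = 0 implies that the complex obtained from P by base change
    along the character a (x) b |-> chi_u(a) chi_v(b) of E is exact in degree n
    ([Tor_bichar_exact]). This is a complex of vector spaces: it computes
    Tor_n(S(v,u), A), and its dual over k computes Ext^n(A, S(u,v))
    ([tensor_opchar_exact], [hom_charmod_exact]). The exchange of u and v between
    the two cases is the difference between + and co+.

    If HH is nonzero in infinitely many degrees, then in each of them some pair
    of vertices with a nonzero corner has a nonzero Tor. There are finitely many
    pairs, so one of them serves for infinitely many degrees
    ([graded_infinite_pigeonhole]). *)

Set Implicit Arguments.
Unset Strict Implicit.
Unset Printing Implicit Defensive.

Import GRing.Theory.
Local Open Scope ring_scope.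
Local Open Scope classical_set_scope.
Local Open Scope quotient_scope.

(** * Linear maps given by choice, and complements of subspaces *)

Section Bundling.
Variables (R : pzRingType) (U V : lmodType R) (f : U -> V) (lf : linear f).

(** The linearity proof is kept as an argument of the function, so that the
    canonical linear structure can find it again. *)
Definition bundled : U -> V := let _ := lf in f.
HB.instance Definition _ := GRing.isLinear.Build R U V _ bundled lf.
Definition bundle : {linear U -> V} := bundled.

End Bundling.
Arguments bundle {R U V f} lf.

(** Turns a pointwise existence statement into a linear map. The second
    hypothesis determines the value at a linear combination from the values
    already chosen, which forces any choice function to be linear. *)
Lemma linear_choice (R : pzRingType) (U V : lmodType R) (r : U -> V -> Prop) :
    (forall u, exists v, r u v) ->
    (forall a u u' v v' w, r u v -> r u' v' -> r (a *: u + u') w ->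
      w = a *: v + v') ->
  exists f : {linear U -> V}, forall u, r u (f u).
Proof.
move=> /choice[f rf] rl; have lf : linear f by move=> a u v; exact: rl.
by exists (bundle lf).
Qed.

(** Chain maps and homotopies are built degree by degree: [r] is the equation
    between two consecutive components, [G] the invariant that makes the next
    one exist. *)
Lemma dependent_choice (T : nat -> Type) (G : forall n, T n -> Prop)
    (r : forall n, T n -> T n.+1 -> Prop) (t0 : T 0) :
    G 0 t0 ->
    (forall n t, G n t -> exists2 t', G n.+1 t' & r n t t') ->
  exists s : forall n, T n, s 0 = t0 /\ forall n, r n (s n) (s n.+1).
Proof.
move=> G0 step.
pose S n := {t : T n | G n t}.
have next n (t : S n) : {t' : S n.+1 | r n (sval t) (sval t')}.
  by have [t' Gt' rt'] := cid2 (step n _ (svalP t)); exists (exist _ t' Gt').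
pose s := fix s n : S n :=
  if n is m.+1 then sval (next m (s m)) else exist _ t0 G0.
by exists (fun n => sval (s n)); split=> // n; exact: (svalP (next n (s n))).
Qed.

Section Subspaces.
Variables (k : fieldType) (V : lmodType k) (U : set V).
Hypotheses (U0 : U 0) (UL : forall a u v, U u -> U v -> U (a *: u + v)).

Let UZ a u : U u -> U (a *: u).
Proof. by move=> Uu; rewrite -[_ *: _]addr0; exact: UL. Qed.

Let UB u v : U u -> U v -> U (u - v).
Proof. by move=> Uu Uv; rewrite addrC -scaleN1r; exact: UL. Qed.

(** By Zorn there is a maximal subspace W that meets U in 0, and it is a
    complement of U: a vector outside U + W could be added to W. The bases of
    the standard resolutions are infinite, so no finite elimination would do. *)
Lemma subspace_projection :
  exists e : {linear V -> V}, (forall v, U (e v)) /\ forall u, U u -> e u = u.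
Proof.
(* Nothing in P forces 0 to be in W, so that the union of the empty chain
   qualifies; maximality puts 0 into W afterwards. *)
pose P : set (set V) := [set W | (forall a u v, W u -> W v -> W (a *: u + v)) /\
  forall w, W w -> U w -> w = 0].
have [F PF tF|W [[WL WU] Wmax]] := @Zorn_bigcup _ P.
  split=> [a u v [X FX Xu] [Y FY Yv]|w [X FX Xw]]; last first.
    by have [_] := PF X FX; exact.
  have [XY|YX] := tF _ _ FX FY.
    by exists Y => //; have [L _] := PF Y FY; apply: L => //; exact: XY.
  by exists X => //; have [L _] := PF X FX; apply: L => //; exact: YX.
have maxE (B : set V) : W `<=` B -> P B -> B `<=` W.
  by move=> WB PB; apply: contrapT => BW; exact: (Wmax B).
have W0 : W 0.
  apply: (maxE (fun v => W v \/ v = 0)); last by right.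
    by move=> v; left.
  split=> [a u v [Wu|->] [Wv|->]|w [Ww|//] Uw]; last exact: WU.
  - by left; exact: WL.
  - by left; have := WL (a - 1) _ _ Wu Wu; rewrite scalerBl scale1r subrK addr0.
  - by left; rewrite scaler0 add0r.
  - by right; rewrite scaler0 addr0.
have WZ a w : W w -> W (a *: w).
  by move=> Ww; rewrite -[_ *: _]addr0; exact: WL.
have WB w w' : W w -> W w' -> W (w - w').
  by move=> Ww Ww'; rewrite addrC -scaleN1r; exact: WL.
have dec v : exists u, U u /\ W (v - u).
  apply: contrapT => nv.
  suff /(_ v) : [set t | exists c w, W w /\ t = c *: v + w] `<=` W.
    have Wv : exists c w, W w /\ v = c *: v + w.
      by exists 1, 0; rewrite scale1r addr0.
    by move=> /(_ Wv) {}Wv; apply: nv; exists 0; rewrite subr0.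
  apply: maxE => [w Ww|]; first by exists 0, w; rewrite scale0r add0r.
  split=> [a _ _ [c [w [Ww ->]]] [c' [w' [Ww' ->]]]|_ [c [w [Ww ->]]] Uw].
    exists (a * c + c'), (a *: w + w'); split; first exact: WL.
    by rewrite scalerDr scalerA addrACA scalerDl.
  have [c0|c0] := eqVneq c 0.
    by move: Uw; rewrite c0 scale0r add0r; exact: WU.
  case: nv; exists (c^-1 *: (c *: v + w)); split; first exact: UZ.
  rewrite scalerDr scalerA mulVf // scale1r opprD addrA subrr add0r -scaleNr.
  exact: WZ.
have [|e eP] := @linear_choice k V V (fun v u => U u /\ W (v - u)) dec.
  move=> a u u' v v' w [Uv Wv] [Uv' Wv'] [Uw Ww].
  apply/eqP; rewrite -subr_eq0; apply/eqP; apply: WU; last first.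
    by apply: UB => //; exact: UL.
  have -> : w - (a *: v + v') =
      (a *: (u - v) + (u' - v')) - (a *: u + u' - w).
    by rewrite scalerBr addrACA -opprD opprB [RHS]addrC addrA subrK.
  by apply: WB => //; exact: WL.
exists e; split=> [v|u Uu]; first by have [] := eP v.
have [Ue We] := eP u.
by apply/esym/eqP; rewrite -subr_eq0; apply/eqP/WU => //; exact: UB.
Qed.

End Subspaces.

(** To define s at w, lift the projection of w onto the range of d, and
    subtract from the lift its projection onto the kernel of d: the result no
    longer depends on the lift. Two uses are intended: s is a section when d is
    surjective, and f \o s extends a functional f that vanishes on the kernel
    of d. *)
Lemma linear_ginverse (k : fieldType) (V W : lmodType k) (d : {linear V -> W}) :
  exists s : {linear W -> V}, forall v, d (s (d v)) = d v.
Proof.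
have [||e [eU eE]] := @subspace_projection k V (fun v => d v = 0).
- exact: raddf0.
- by move=> a u v u0 v0; rewrite linearP u0 v0 scaler0 addr0.
have [||p [pU pE]] := @subspace_projection k W (range d).
- by exists 0 => //; exact: raddf0.
- by move=> a _ _ [u _ <-] [v _ <-]; exists (a *: u + v) => //; rewrite linearP.
have [w||s sP] :=
    @linear_choice k W V (fun w v => exists2 x, d x = p w & v = x - e x).
- by have [x _ dx] := pU w; exists (x - e x), x.
- move=> a w w' _ _ _ [x dx ->] [x' dx' ->] [y dy ->].
  have : d (y - (a *: x + x')) = 0.
    by rewrite raddfB /= dy (linearP p) (linearP d) dx dx' subrr.
  move=> /eE; rewrite raddfB /= (linearP e) => yE.
  rewrite scalerBr addrACA -opprD; apply/eqP; rewrite subr_eq; apply/eqP.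
  by rewrite -[LHS](subrK (a *: x + x')) -yE [LHS]addrC [LHS]addrCA [LHS]addrC.
exists s => v; have [x dx ->] := sP (d v).
by rewrite raddfB /= eU subr0 dx pE //; exists v.
Qed.

(** * Exactness at one degree, and comparison of resolutions *)

Section Exactness.
Variables (C : nat -> zmodType) (d : forall n, C n.+1 -> C n).

(** In degree 0 the differential out of the complex is zero, hence every
    element is a cycle. *)
Definition is_cycle n : C n -> Prop :=
  if n is m.+1 return C n -> Prop then fun x => d x = 0 else fun=> True.

Definition exact_at n := forall x : C n, is_cycle x -> exists y, d y = x.

End Exactness.
Arguments is_cycle {C} d {n} x.
Arguments exact_at {C} d n.

(** A cycle x of D is the sum of x - f (g x), which bounds by hypothesis, and
    of f (g x), which bounds because g x does. Applied to isomorphisms of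
    complexes and to homotopy equivalences. *)
Lemma exact_at_retract (C D : nat -> zmodType)
    (dC : forall n, {additive C n.+1 -> C n})
    (dD : forall n, {additive D n.+1 -> D n})
    (f : forall n, {additive C n -> D n}) (g : forall n, {additive D n -> C n})
    n :
    (forall m x, f m (dC m x) = dD m (f m.+1 x)) ->
    (forall m x, g m (dD m x) = dC m (g m.+1 x)) ->
    (forall x : D n, is_cycle dD x -> exists y, dD n y = x - f n (g n x)) ->
  exact_at dC n -> exact_at dD n.
Proof.
move=> fd gd fg exC x cx.
have [|w dw] := exC (g n x).
  by case: n x cx {fg exC} => //= m x x0; rewrite -gd x0 raddf0.
have [y dy] := fg x cx.
by exists (y + f n.+1 w); rewrite raddfD /= dy -fd dw subrK.
Qed.

Lemma homology_eq0 (A B C : zmodType) (f : {additive A -> B})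
    (g : {additive B -> C}) :
  (forall v : homology f g, v = 0) <-> (forall b, g b = 0 -> exists a, f a = b).
Proof.
split=> [h0 b /eqP gb|ex v].
  pose z : cycles g := Cycle (gb : b \in cycle_pred g).
  have : \pi_(Quotient.quot (boundary_pred f (g:=g))) z =
         \pi_(Quotient.quot (boundary_pred f (g:=g))) 0.
    by rewrite raddf0; exact: h0.
  by move=> /eqP; rewrite -Quotient.idealrBE subr0 => /asboolP.
rewrite -[v]reprK -[RHS](raddf0 (\pi_(Quotient.quot (boundary_pred f (g:=g))))).
apply/eqP; rewrite -Quotient.idealrBE subr0; apply/asboolP.
by apply: ex; exact/eqP/cycleP.
Qed.

Lemma Tor_res_eq0 (R : pzRingType) (M : lmodType R^c) (N : lmodType R)
    (P : resolution N) n :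
  (forall v : Tor_res M P n, v = 0) <->
  exact_at (fun m => tmap M (res_d P m)) n.
Proof.
case: n => [|n]; split.
- by move=> /homology_eq0 ex x _; exact: ex.
- by move=> ex; apply/homology_eq0 => x _; exact: ex.
- by move=> /homology_eq0 ex x; exact: ex.
- by move=> ex; apply/homology_eq0 => x; exact: ex.
Qed.

Section TensorFunctor.
Variables (R : pzRingType) (M : lmodType R^c).

Lemma tensor_ext (N : lmodType R) (V : zmodType) (f g : {additive tensor M N -> V}) :
  (forall m n, f (tens m n) = g (tens m n)) -> f =1 g.
Proof.
move=> fg; elim/tensor_ind => [|t t' h h'|//]; first by rewrite !raddf0.
by rewrite !raddfB h h'.
Qed.

Lemma tens0l (N : lmodType R) (n : N) : tens (0 : M) n = 0.
Proof. by apply: (addrI (tens (0 : M) n)); rewrite -tensDl !addr0. Qed.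

Lemma tens0r (N : lmodType R) (m : M) : tens m (0 : N) = 0.
Proof. by apply: (addrI (tens m (0 : N))); rewrite -tensDr !addr0. Qed.

Lemma tensBr (N : lmodType R) (m : M) (n n' : N) :
  tens m (n - n') = tens m n - tens m n'.
Proof. by apply/eqP; rewrite eq_sym subr_eq -tensDr subrK. Qed.

End TensorFunctor.

Lemma eq_exact_at (C : nat -> zmodType) (d d' : forall n, C n.+1 -> C n) n :
  (forall m, d m =1 d' m) -> exact_at d n -> exact_at d' n.
Proof.
move=> dd' ex x cx; have [|y <-] := ex x; last by exists y; rewrite dd'.
by case: n x cx {ex} => //= n x; rewrite dd'.
Qed.

(** The simple modules of a bound quiver algebra and the abstract
    one-dimensional modules used below are isomorphic but not the same
    structures; resolutions are moved between them. *)
Section ResolutionTransport.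
Variables (R : pzRingType) (M N : lmodType R) (P : resolution M).
Variables (f : {linear M -> N}) (g : N -> M).
Hypotheses (fK : cancel f g) (gK : cancel g f).

Let aug : {linear res_mod P 0 -> N} := f \o res_aug P.

Let aug_surj y : exists x, aug x = y.
Proof. by have [x xE] := res_surj P (g y); exists x; rewrite /= xE gK. Qed.

Let aug_exact x : aug x = 0 <-> exists y, res_d P 0 y = x.
Proof.
rewrite -(@res_exact0 _ _ P); split=> /= [x0|->]; last exact: raddf0.
by rewrite -[LHS]fK x0 -[in LHS](raddf0 f) fK.
Qed.

Definition transport_resolution : resolution N :=
  Resolution (@res_proj _ _ P) aug_surj aug_exact (@res_exactS _ _ P).

End ResolutionTransport.

Section Comparison.
Variable R : pzRingType.

(** The maps f and d1 both land in the kernel of d0, and d1 maps onto it; so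
    projectivity applies with this kernel as target. *)
Lemma projective_lift (P A B C : lmodType R) (d1 : {linear A -> B})
    (d0 : {linear B -> C}) (f : {linear P -> B}) :
    projective P -> (forall b, d0 b = 0 -> exists a, d1 a = b) ->
    (forall a, d0 (d1 a) = 0) -> (forall x, d0 (f x) = 0) ->
  exists g : {linear P -> A}, forall x, d1 (g x) = f x.
Proof.
move=> prP ex dd df.
have into (X : lmodType R) (h : {linear X -> B}) : (forall x, d0 (h x) = 0) ->
    exists h' : {linear X -> kermod d0}, forall x, val (h' x) = h x.
  move=> dh; apply: (@linear_choice _ X (kermod d0) (fun x y => val y = h x)).
    move=> x; by exists (KerMod (introT eqP (dh x) : h x \in ker_pred d0)).
  move=> a x x' y y' z yx yx' zx.
  apply: val_inj; rewrite [LHS]zx (linearP h) -yx -yx'.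
  exact/esym/(linearP (val : kermod d0 -> B)).
have [e ed] := into _ _ dd; have [f' fE] := into _ _ df.
have [|g gE] := prP _ _ e f'.
  move=> b; have [a da] := ex (val b) (eqP (kermodP b)).
  by exists a; apply: val_inj; rewrite ed.
by exists g => x; rewrite -ed gE fE.
Qed.

Variable N : lmodType R.

Lemma res_dd (P : resolution N) n x : res_d P n (res_d P n.+1 x) = 0.
Proof. by apply/res_exactS; exists x. Qed.

Lemma res_aug_d (P : resolution N) x : res_aug P (res_d P 0 x) = 0.
Proof. by apply/res_exact0; exists x. Qed.

(** The component in degree n.+1 lifts the composite of the one in degree n
    with the differential; this composite consists of cycles, which is the
    invariant [G], and cycles of Q are boundaries. *)
Lemma chain_lift (P Q : resolution N) :
  exists f : forall n, {linear res_mod P n -> res_mod Q n},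
    (forall x, res_aug Q (f 0 x) = res_aug P x) /\
    forall n x, res_d Q n (f n.+1 x) = f n (res_d P n x).
Proof.
have [f0 f0E] := @res_proj _ _ P 0 _ _ _ (res_aug P) (@res_surj _ _ Q).
pose G n : {linear res_mod P n -> res_mod Q n} -> Prop :=
  if n is m.+1 return {linear res_mod P n -> res_mod Q n} -> Prop
  then fun f => forall x, res_d Q m (f (res_d P m.+1 x)) = 0
  else fun f => forall x, res_aug Q (f (res_d P 0 x)) = 0.
have [||f [fz fS]] := @dependent_choice
    (fun n => {linear res_mod P n -> res_mod Q n}) G
    (fun n f f' => forall x, res_d Q n (f' x) = f (res_d P n x)) f0.
- by move=> x; rewrite f0E res_aug_d.
- move=> n f Gf.
  suff [f' f'E] : exists f' : {linear res_mod P n.+1 -> res_mod Q n.+1},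
      forall x, res_d Q n (f' x) = f (res_d P n x).
    by exists f' => //= x; rewrite f'E res_dd raddf0.
  case: n f Gf => [|n] f Gf.
  + apply: (@projective_lift _ _ _ _ (res_d Q 0) (res_aug Q) (f \o res_d P 0)) => //.
    * exact: res_proj.
    * by move=> b /res_exact0.
    * exact: res_aug_d.
  + apply: (@projective_lift _ _ _ _ (res_d Q n.+1) (res_d Q n)
      (f \o res_d P n.+1)) => //.
    * exact: res_proj.
    * by move=> b /res_exactS.
    * exact: res_dd.
- by exists f; rewrite fz.
Qed.

(** A chain map that induces 0 on N is null-homotopic: once h is known in degree
    n, the map f n.+1 - h n \o d takes its values in cycles and lifts. *)
Lemma null_homotopy (P : resolution N)
    (f : forall n, {linear res_mod P n -> res_mod P n}) :
    (forall x, res_aug P (f 0 x) = 0) ->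
    (forall n x, res_d P n (f n.+1 x) = f n (res_d P n x)) ->
  exists h : forall n, {linear res_mod P n -> res_mod P n.+1},
    (forall x, f 0 x = res_d P 0 (h 0 x)) /\
    forall n x, f n.+1 x = res_d P n.+1 (h n.+1 x) + h n (res_d P n x).
Proof.
move=> f0 fd.
have [|||h0 h0E] := @projective_lift _ _ _ _ (res_d P 0) (res_aug P) (f 0)
  (@res_proj _ _ P 0).
- by move=> b /res_exact0.
- exact: res_aug_d.
- exact: f0.
pose T n := {linear res_mod P n -> res_mod P n.+1}.
pose G n (h : T n) := forall x, f n (res_d P n x) = res_d P n (h (res_d P n x)).
have [||h [hz hS]] := @dependent_choice T G
    (fun n h h' => forall x, f n.+1 x = res_d P n.+1 (h' x) + h (res_d P n x)) h0.
- by move=> x; rewrite h0E.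
- move=> n h Gh.
  pose F : {linear res_mod P n.+1 -> res_mod P n.+1} :=
    f n.+1 \- (h \o res_d P n).
  have [|||h' h'E] := @projective_lift _ _ _ _ (res_d P n.+1) (res_d P n) F
    (@res_proj _ _ P n.+1).
  + by move=> b /res_exactS.
  + exact: res_dd.
  + by move=> x; rewrite /F /= raddfB /= fd Gh subrr.
  exists h' => x; rewrite h'E /F /=.
    by rewrite res_dd raddf0 subr0.
  by rewrite subrK.
- by exists h; rewrite hz; split=> // x; rewrite h0E.
Qed.

(** Chain maps f and g in both directions over the identity of N exist, and
    id - f \o g induces 0 on N, hence is null-homotopic. Homotopies survive
    tensoring with M. *)
Lemma Tor_res_comparison (M : lmodType R^c) (P Q : resolution N) n :
  exact_at (fun m => tmap M (res_d P m)) n ->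
  exact_at (fun m => tmap M (res_d Q m)) n.
Proof.
have [f [f0 fd]] := chain_lift P Q; have [g [g0 gd]] := chain_lift Q P.
pose u m : {linear res_mod Q m -> res_mod Q m} := idfun \- (f m \o g m).
have [||h [h0 hS]] := @null_homotopy Q u.
- by move=> x; rewrite /= raddfB /= f0 g0 subrr.
- by move=> m x; rewrite /= raddfB /= fd gd.
apply: (@exact_at_retract _ _ (fun m => tmap M (res_d P m))
  (fun m => tmap M (res_d Q m)) (fun m => tmap M (f m)) (fun m => tmap M (g m))).
- move=> m; apply: (@tensor_ext _ _ _ _ (tmap M (f m) \o tmap M (res_d P m))
    (tmap M (res_d Q m) \o tmap M (f m.+1))) => x y /=.
  by rewrite !tmapE fd.
- move=> m; apply: (@tensor_ext _ _ _ _ (tmap M (g m) \o tmap M (res_d Q m))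
    (tmap M (res_d P m) \o tmap M (g m.+1))) => x y /=.
  by rewrite !tmapE gd.
case: n => [|n] x /= dx.
  exists (tmap M (h 0) x).
  apply: (@tensor_ext _ _ _ _ (tmap M (res_d Q 0) \o tmap M (h 0))
    (idfun \- (tmap M (f 0) \o tmap M (g 0)))) => {dx}x y /=.
  by rewrite !tmapE -h0 /= tensBr.
exists (tmap M (h n.+1) x).
rewrite -[LHS]addr0 -[X in _ + X](raddf0 (tmap M (h n))) -dx.
apply: (@tensor_ext _ _ _ _
  ((tmap M (res_d Q n.+1) \o tmap M (h n.+1)) \+
   (tmap M (h n) \o tmap M (res_d Q n)))
  (idfun \- (tmap M (f n.+1) \o tmap M (g n.+1)))) => {dx}x y /=.
by rewrite !tmapE -tensDr -hS /= tensBr.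
Qed.

End Comparison.

(** * Free modules, base change, and one-dimensional coefficients *)

Section FreeModule.
Variables (R : pzRingType) (X : choiceType).

Lemma freemod_ind (P : freemod R X -> Prop) :
    P 0 -> (forall u v, P u -> P v -> P (u + v)) ->
    (forall c x, P (c *: fgen R x)) ->
  forall u, P u.
Proof.
move=> P0 PD PZ; apply: malg_ind => [//|//|c x].
by have := PZ c x; rewrite freescaleU mulr1.
Qed.

Definition fcoeff (x : X) (u : freemod R X) : R := mcoeff x u.

Lemma fcoeff_is_zmod_morphism x : zmod_morphism (fcoeff x).
Proof. exact: mcoeffB. Qed.

HB.instance Definition _ x := GRing.isZmodMorphism.Build _ _ (fcoeff x)
  (fcoeff_is_zmod_morphism x).

Lemma fcoeffZ x c u : fcoeff x (c *: u) = c * fcoeff x u.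
Proof. exact: freescaleE. Qed.

Lemma fcoeff_gen x y : fcoeff x (fgen R y) = (y == x)%:R.
Proof. exact: mcoeffU. Qed.

End FreeModule.

(** On free modules with a chosen basis, base change along a ring morphism is
    the application of this morphism to coefficients and to matrix entries.
    All tensor products with resolutions are computed in this form. *)
Section BaseChange.
Variables (R S : pzRingType) (rho : {rmorphism R -> S}).

Definition bchange (X : choiceType) (u : freemod R X) : freemod S X :=
  msum (fun x (c : R) => << rho c *g x >> : {malg S[X]}) u.

Let FB (X : choiceType) : forall x : X,
  zmod_morphism (fun c : R => << rho c *g x >> : {malg S[X]}).
Proof. by move=> x c c'; rewrite raddfB monalgUB. Qed.

Lemma bchange_is_zmod_morphism X : zmod_morphism (@bchange X).
Proof. exact: (msum_is_zmod_morphism (@FB X)). Qed.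

HB.instance Definition _ X := GRing.isZmodMorphism.Build _ _ (@bchange X)
  (@bchange_is_zmod_morphism X).

Lemma bchange_genZ (X : choiceType) c (x : X) :
  bchange (c *: fgen R x) = rho c *: fgen S x.
Proof.
by rewrite freescaleU mulr1 [LHS](msumU (@FB X)) freescaleU mulr1.
Qed.

Lemma bchange_gen (X : choiceType) (x : X) : bchange (fgen R x) = fgen S x.
Proof. by rewrite -[fgen R x]scale1r bchange_genZ rmorph1 scale1r. Qed.

Lemma bchangeZ (X : choiceType) c (u : freemod R X) :
  bchange (c *: u) = rho c *: bchange u.
Proof.
elim/freemod_ind: u => [|u v hu hv|b x]; first by rewrite !(scaler0, raddf0).
  by rewrite !(scalerDr, raddfD) /= hu hv.
by rewrite scalerA !bchange_genZ rmorphM scalerA.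
Qed.

Lemma bchange_surj (X : choiceType) : (forall s, exists r, rho r = s) ->
  forall v : freemod S X, exists u, bchange u = v.
Proof.
move=> rS; elim/freemod_ind => [|v w [u <-] [u' <-]|s x].
- by exists 0; rewrite raddf0.
- by exists (u + u'); rewrite raddfD.
- by have [r <-] := rS s; exists (r *: fgen R x); rewrite bchange_genZ.
Qed.

Definition bchange_map (X Y : choiceType) (d : {linear freemod R X -> freemod R Y}) :
    {linear freemod S X -> freemod S Y} :=
  flift (fun x => bchange (d (fgen R x))).

Lemma bchange_mapE (X Y : choiceType) (d : {linear freemod R X -> freemod R Y}) u :
  bchange_map d (bchange u) = bchange (d u).
Proof.
elim/freemod_ind: u => [|u v hu hv|c x]; first by rewrite !raddf0.
  by rewrite !raddfD /= hu hv.
by rewrite bchange_genZ !linearZ /= fliftE bchangeZ.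
Qed.

End BaseChange.
Arguments bchange {R S} rho {X} u.
Arguments bchange_map {R S} rho {X Y} d.

Lemma bchange_comp (R S T : pzRingType) (rho : {rmorphism R -> S})
    (sigma : {rmorphism S -> T}) (X : choiceType) (u : freemod R X) :
  bchange sigma (bchange rho u) = bchange (sigma \o rho : {rmorphism _ -> _}) u.
Proof.
elim/freemod_ind: u => [|u v hu hv|c x]; first by rewrite !raddf0.
  by rewrite !raddfD /= hu hv.
by rewrite !bchange_genZ.
Qed.

Lemma bchange_map_comp (R S T : pzRingType) (rho : {rmorphism R -> S})
    (sigma : {rmorphism S -> T}) (X Y : choiceType)
    (d : {linear freemod R X -> freemod R Y}) :
  bchange_map sigma (bchange_map rho d) =1
  bchange_map (sigma \o rho : {rmorphism _ -> _}) d.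
Proof.
apply: freemod_ext => x.
by rewrite [LHS]fliftE [bchange_map rho d _]fliftE bchange_comp [RHS]fliftE.
Qed.

Section CharacterModule.
Variables (R : pzRingType) (k : fieldType) (chi : {rmorphism R -> k}).

(** Two uses of the same carrier k with different characters must be different
    types for instance inference, hence the phantom argument. *)
Definition charmod of {rmorphism R -> k} : Type := k.
HB.instance Definition _ := GRing.Zmodule.copy (charmod chi) k.

Definition charscale (r : R) (c : charmod chi) : charmod chi := chi r * (c : k).

Lemma charscaleA r s c : charscale r (charscale s c) = charscale (r * s) c.
Proof. by rewrite /charscale rmorphM mulrA. Qed.

Lemma charscale1 : left_id 1 charscale.
Proof. by move=> c; rewrite /charscale rmorph1; exact: mul1r. Qed.

Lemma charscaleDr : right_distributive charscale +%R.
Proof. by move=> r c d; exact: mulrDr. Qed.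

Lemma charscaleDl c : {morph charscale^~ c : r s / r + s}.
Proof. by move=> r s; rewrite /charscale raddfD; exact: mulrDl. Qed.

HB.instance Definition _ := GRing.Zmodule_isLmodule.Build R (charmod chi)
  charscaleA charscale1 charscaleDr charscaleDl.

(** Since k is commutative, a character of R is also one of the converse ring;
    this turns a character into a right module. *)
Definition opchar (r : R^c) : k := chi (r : R).

Lemma opchar_is_zmod_morphism : zmod_morphism opchar.
Proof. by move=> r s; exact: raddfB. Qed.

Lemma opchar_is_monoid_morphism : monoid_morphism opchar.
Proof.
split=> [|r s]; first exact: (rmorph1 chi).
by rewrite mulrC; exact: (rmorphM chi).
Qed.

HB.instance Definition _ := GRing.isZmodMorphism.Build R^c k opchar
  opchar_is_zmod_morphism.
HB.instance Definition _ := GRing.isMonoidMorphism.Build R^c k opchar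
  opchar_is_monoid_morphism.

End CharacterModule.

(** If M is one-dimensional with character chi, then tensoring with M a free
    module with basis X gives the vector space with basis X, that is, base
    change along chi. *)
Section TorCharacter.
Variables (R : pzRingType) (k : fieldType) (chi : {rmorphism R -> k}).
Variables (M : lmodType R^c) (th : {additive M -> k}) (th' : {additive k -> M}).
Hypotheses (thK : cancel th th') (thK' : cancel th' th).
Hypothesis thZ : forall (r : R) m, th ((r : R^c) *: m) = th m * chi r.

(* The isomorphism tau and its inverse tau'. *)
Let tau_balanced (X : choiceType) : balanced
  (fun (m : M) (p : freemod R X) => th m *: bchange chi p).
Proof.
split=> [p m m'|m p p'|r m p]; first by rewrite raddfD scalerDl.
  by rewrite raddfD scalerDr.
by rewrite thZ bchangeZ scalerA.
Qed.

Let tau (X : choiceType) : tensor M (freemod R X) -> freemod k X :=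
  tlift (fun m p => th m *: bchange chi p).

Let tauE (X : choiceType) m p :
  tau (tens m p) = th m *: bchange chi p :> freemod k X.
Proof. exact: tliftE (tau_balanced X) m p. Qed.

Let tau_additive (X : choiceType) := GRing.isZmodMorphism.Build _ _ (@tau X)
  (tlift_is_zmod_morphism (tau_balanced X)).
HB.instance Definition _ X := tau_additive X.

Let F (X : choiceType) (x : X) (c : k) : tensor M (freemod R X) :=
  tens (th' c) (fgen R x).

Let FB (X : choiceType) : forall x : X, zmod_morphism (@F X x).
Proof.
move=> x c c'; rewrite /F raddfB; apply/eqP.
by rewrite eq_sym subr_eq -tensDl subrK.
Qed.

Let tau' (X : choiceType) (u : freemod k X) : tensor M (freemod R X) :=
  msum (@F X) u.

Let tau'_additive (X : choiceType) := GRing.isZmodMorphism.Build _ _ (@tau' X)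
  (msum_is_zmod_morphism (@FB X)).
HB.instance Definition _ X := tau'_additive X.

Let tau'E (X : choiceType) c (x : X) :
  tau' (c *: fgen k x) = tens (th' c) (fgen R x).
Proof. by rewrite freescaleU mulr1 [LHS](msumU (@FB X)). Qed.

Let tauK (X : choiceType) : cancel (@tau X) (@tau' X).
Proof.
apply: (@tensor_ext _ _ _ _ (@tau' X \o @tau X) idfun) => m p /=.
rewrite tauE; elim/freemod_ind: p => [|u v hu hv|r x].
- by rewrite raddf0 scaler0 raddf0 tens0r.
- by rewrite raddfD scalerDr raddfD /= hu hv tensDr.
- by rewrite bchange_genZ scalerA tau'E -thZ thK tensZ.
Qed.

Let tau'K (X : choiceType) : cancel (@tau' X) (@tau X).
Proof.
elim/freemod_ind => [|u v hu hv|c x]; first by rewrite !raddf0.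
  by rewrite !raddfD /= hu hv.
by rewrite tau'E tauE thK' bchange_gen.
Qed.

Variables (X : nat -> choiceType).
Variable d : forall n, {linear freemod R (X n.+1) -> freemod R (X n)}.

Let taud n z : bchange_map chi (d n) (tau z) = tau (tmap M (d n) z).
Proof.
apply: (@tensor_ext _ _ _ _ (bchange_map chi (d n) \o @tau _)
  (@tau _ \o tmap M (d n))) => m p /=.
by rewrite tmapE !tauE linearZ /= bchange_mapE.
Qed.

Lemma tensor_charmod_exact n :
  exact_at (fun n => tmap M (d n)) n <->
  exact_at (fun n => bchange_map chi (d n)) n.
Proof.
have tau'd m u : tau' (bchange_map chi (d m) u) = tmap M (d m) (tau' u).
  by rewrite -[u in LHS]tau'K taud tauK.
split.
  apply: (@exact_at_retract _ _ (fun n => tmap M (d n))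
    (fun n => bchange_map chi (d n)) (fun n => @tau (X n))
    (fun n => @tau' (X n))) => // [m x|x _].
    exact/esym/taud.
  by exists 0; rewrite raddf0 /= tau'K subrr.
apply: (@exact_at_retract _ _ (fun n => bchange_map chi (d n))
  (fun n => tmap M (d n)) (fun n => @tau' (X n))
  (fun n => @tau (X n))) => // [m x|x _].
  exact/esym/taud.
by exists 0; rewrite raddf0 /= tauK subrr.
Qed.

End TorCharacter.

Lemma tensor_opchar_exact (R : pzRingType) (k : fieldType)
    (chi : {rmorphism R -> k}) (X : nat -> choiceType)
    (d : forall n, {linear freemod R (X n.+1) -> freemod R (X n)}) n :
  exact_at (fun n => bchange_map chi (d n)) n ->
  exact_at (fun n => tmap
    (charmod (opchar chi : {rmorphism R^c -> k})) (d n)) n.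
Proof.
pose M := charmod (opchar chi : {rmorphism R^c -> k}).
pose th : {additive M -> k} := (idfun : {additive k -> k}).
pose th' : {additive k -> M} := (idfun : {additive k -> k}).
have thZ (r : R) m : th ((r : R^c) *: m) = th m * chi r by exact: mulrC.
have K : cancel th th' by []. have K' : cancel th' th by [].
by move=> ex; apply/(tensor_charmod_exact K K' thZ d n).
Qed.

Section ExtCharacter.

(** Vanishing of the n-th cohomology of Hom(P, N), with linear maps in place of
    the elements of [hom]. *)
Definition coexact_at (R : pzRingType) (P : nat -> lmodType R)
    (d : forall n, {linear P n.+1 -> P n}) (N : lmodType R) (n : nat) : Prop :=
  forall f : {linear P n -> N}, (forall x, f (d n x) = 0) ->
  (if n is m.+1 return {linear P n -> N} -> Prop
   then fun f => exists g : {linear P m -> N}, forall x, g (d m x) = f x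
   else fun f => forall x, f x = 0) f.

Lemma Ext_res_eq0 (R : pzRingType) (M N : lmodType R) (P : resolution M) n :
  coexact_at (res_d P) N n -> forall v : Ext_res P N n, v = 0.
Proof.
have lin (A : lmodType R) (f : Defs.hom A N) : linear f by apply/asboolP/Defs.homP.
case: n => [|n] ex; apply/homology_eq0 => f df.
  exists 0; rewrite raddf0; apply: val_inj; apply/funext => x.
  apply/esym; apply: (ex (bundle (lin _ f))) => y.
  by have := congr1 (fun h : Defs.hom _ _ => h y) df.
have [|g gE] := ex (bundle (lin _ f)).
  by move=> y; have := congr1 (fun h : Defs.hom _ _ => h y) df.
have lg : (g : res_mod P n -> N) \in @Defs.linear_pred _ (res_mod P n) N.
  by apply/asboolP => a u v; exact: linearP.
by exists (Defs.Hom lg); apply: val_inj; apply/funext.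
Qed.

Variables (R : pzRingType) (k : fieldType) (chi : {rmorphism R -> k}).

(* A linear map to charmod chi kills the kernel of chi acting on the free
   module, so it is the same thing as a functional on the base change. *)
Let descend (Y : choiceType) (f : {linear freemod R Y -> charmod chi}) :
  exists g : {linear freemod k Y -> k^o}, forall u, g (bchange chi u) = f u.
Proof.
exists (flift (fun y => f (fgen R y) : k^o)).
elim/freemod_ind => [|u v hu hv|c y]; first by rewrite !raddf0.
  by rewrite !raddfD /= hu hv.
by rewrite bchange_genZ !linearZ /= fliftE.
Qed.

Let ascend (Y : choiceType) (g : {linear freemod k Y -> k^o}) :
  exists f : {linear freemod R Y -> charmod chi}, forall u, f u = g (bchange chi u).
Proof.
have lf : linear (fun u => g (bchange chi u) : charmod chi).
  by move=> a u v; rewrite raddfD /= bchangeZ linearP.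
by exists (bundle lf).
Qed.

Variables (X : nat -> choiceType).
Variable d : forall n, {linear freemod R (X n.+1) -> freemod R (X n)}.

(** Duality over k: linear maps into charmod chi are functionals on the base
    change to k. A cocycle is a functional that kills boundaries, hence cycles
    by exactness; so it factors through the differential on its image, and
    extends from there. *)
Lemma hom_charmod_exact n : (forall c, exists r, chi r = c) ->
  exact_at (fun n => bchange_map chi (d n)) n ->
  @coexact_at R (fun n => freemod R (X n)) d (charmod chi) n.
Proof.
move=> chiS; have bS Y := @bchange_surj _ _ chi Y chiS.
move=> ex f fd; have [g gf] := descend f.
have gd u : g (bchange_map chi (d n) u) = 0.
  by have [w <-] := bS _ u; rewrite bchange_mapE gf fd.
have {ex}gc u : is_cycle (fun n => bchange_map chi (d n)) u -> g u = 0.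
  by move=> /ex[w <-].
case: n f fd g gf gd gc => [|n] f fd g gf gd gc.
  by move=> x; rewrite -gf gc.
have [s sP] := linear_ginverse (bchange_map chi (d n)).
have [h hE] := ascend (g \o s : {linear _ -> _}).
exists h => x; rewrite hE -bchange_mapE /= -gf; apply/eqP.
rewrite -subr_eq0 -(raddfB g); apply/eqP/gc.
by rewrite /= raddfB /= sP subrr.
Qed.

End ExtCharacter.

(** * Exactness in the coefficients, and filtrations *)

Section TensorMapLeft.
Variables (R : pzRingType) (M M' : lmodType R^c) (i : {linear M' -> M}).
Variable N : lmodType R.

Lemma tmapl_balanced : balanced (fun m (n : N) => tens (i m) n : tensor M N).
Proof.
split=> [n m m'|m n n'|r m n]; first by rewrite raddfD tensDl.
  exact: tensDr.
by rewrite linearZ tensZ.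
Qed.

Definition tmapl : tensor M' N -> tensor M N := tlift (fun m n => tens (i m) n).

Lemma tmaplE m n : tmapl (tens m n) = tens (i m) n.
Proof. exact: tliftE tmapl_balanced m n. Qed.

HB.instance Definition _ := GRing.isZmodMorphism.Build _ _ tmapl
  (tlift_is_zmod_morphism tmapl_balanced).

End TensorMapLeft.
Arguments tmapl {R M M'} i {N} _.

Lemma tmapl_tmap (R : pzRingType) (M M' : lmodType R^c) (i : {linear M' -> M})
    (N N' : lmodType R) (d : {linear N -> N'}) z :
  tmapl i (tmap M' d z) = tmap M d (tmapl i z).
Proof.
apply: (@tensor_ext _ _ _ _ (tmapl i \o tmap M' d)
  (tmap M d \o tmapl i)) => m n /=.
by rewrite tmapE !tmaplE tmapE.
Qed.

(** An element of the tensor product of M with a free module is determined by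
    its coordinates in M; they make the functor visibly exact in M. *)
Section TensorCoordinates.
Variables (R : pzRingType) (M : lmodType R^c) (X : choiceType).
Local Notation MX := (tensor M (freemod R X)).

Lemma tcoord_balanced x : balanced
  (fun (m : M) (p : freemod R X) => (fcoeff x p : R^c) *: m).
Proof.
split=> [p m m'|m p p'|r m p]; first exact: scalerDr.
  by rewrite raddfD scalerDl.
by rewrite fcoeffZ scalerA.
Qed.

Definition tcoord (x : X) : MX -> M :=
  tlift (fun m (p : freemod R X) => (fcoeff x p : R^c) *: m).

Lemma tcoordE x m p : tcoord x (tens m p) = (fcoeff x p : R^c) *: m.
Proof. exact: tliftE (tcoord_balanced x) m p. Qed.

HB.instance Definition _ x := GRing.isZmodMorphism.Build _ _ (tcoord x)
  (tlift_is_zmod_morphism (tcoord_balanced x)).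

(** The finite support is only bounded, and not computed: this makes the
    statement stable under subtraction, where the supports are united. *)
Lemma tcoord_sum (z : MX) : exists D : {fset X}, forall D', (D `<=` D')%fset ->
  z = \sum_(x <- D') tens (tcoord x z) (fgen R x).
Proof.
have P0 : exists D : {fset X}, forall D', (D `<=` D')%fset ->
    0 = \sum_(x <- D') tens (tcoord x 0) (fgen R x) :> MX.
  by exists fset0 => D' _; rewrite big1 // => x _; rewrite raddf0 tens0l.
have PB (t t' : MX) : (exists D : {fset X}, forall D', (D `<=` D')%fset ->
      t = \sum_(x <- D') tens (tcoord x t) (fgen R x)) ->
    (exists D : {fset X}, forall D', (D `<=` D')%fset ->
      t' = \sum_(x <- D') tens (tcoord x t') (fgen R x)) ->
    exists D : {fset X}, forall D', (D `<=` D')%fset ->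
      t - t' = \sum_(x <- D') tens (tcoord x (t - t')) (fgen R x).
  move=> [D HD] [E HE]; exists (D `|` E)%fset => D' sD'.
  have tE := HD D' (fsubset_trans (fsubsetUl _ _) sD').
  have t'E := HE D' (fsubset_trans (fsubsetUr _ _) sD').
  rewrite (eq_bigr (fun x => tens (tcoord x t) (fgen R x) -
    tens (tcoord x t') (fgen R x))); first by rewrite sumrB -tE -t'E.
  by move=> x _; apply/eqP; rewrite eq_sym subr_eq -tensDl raddfB /= subrK.
elim/tensor_ind: z => [//|t t'|m p]; first exact: PB.
elim/freemod_ind: p => [|u v hu hv|c x].
- by rewrite tens0r.
- rewrite tensDr -[tens m v]opprK; apply: (PB _ _ hu).
  by rewrite -sub0r; exact: PB.
exists [fset x]%fset => D' /fsubsetP /(_ x (fset11 x)) xD'.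
rewrite (big_fsetD1 x xD') /= big1_seq => [|y].
  by rewrite tcoordE fcoeffZ fcoeff_gen eqxx mulr1 addr0 tensZ.
rewrite !inE => /andP[_ /andP[yx _]].
by rewrite tcoordE fcoeffZ fcoeff_gen eq_sym (negbTE yx) mulr0 scale0r tens0l.
Qed.

End TensorCoordinates.

Section ShortExactTensor.
Variables (R : pzRingType) (M M' M'' : lmodType R^c).
Variables (i : {linear M' -> M}) (f : {linear M -> M''}).
Hypotheses (i_inj : injective i) (f_surj : forall m, exists n, f n = m).
Hypothesis if_exact : forall m, f m = 0 -> exists m', i m' = m.

Let tmapl_coord (N N' : lmodType R^c) (g : {linear N -> N'})
    (X : choiceType) (x : X) z :
  tcoord x (tmapl g z : tensor N' (freemod R X)) = g (tcoord x z).
Proof.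
apply: (@tensor_ext _ _ _ _ (@tcoord _ _ X x \o tmapl g)
  (g \o @tcoord _ _ X x)) => m p /=.
by rewrite tmaplE !tcoordE linearZ.
Qed.

Lemma tmapl_surj (N : lmodType R) z :
  exists y, tmapl f y = z :> tensor M'' N.
Proof.
elim/tensor_ind: z => [|t t' [y <-] [y' <-]|m n]; first by exists 0; rewrite raddf0.
  by exists (y - y'); rewrite raddfB.
by have [m' <-] := f_surj m; exists (tens m' n); rewrite tmaplE.
Qed.

Lemma tmapl_free_inj (X : choiceType) (z : tensor M' (freemod R X)) :
  tmapl i z = 0 -> z = 0.
Proof.
move=> z0; have [D /(_ D (fsubset_refl D)) ->] := tcoord_sum z.
rewrite big1 // => x _; have -> : tcoord x z = 0; last exact: tens0l.
by apply: i_inj; rewrite -tmapl_coord z0 !raddf0.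
Qed.

Lemma tmapl_free_exact (X : choiceType) (z : tensor M (freemod R X)) :
  tmapl f z = 0 -> exists y, tmapl i y = z.
Proof.
move=> z0; have [D /(_ D (fsubset_refl D)) ->] := tcoord_sum z.
elim/big_ind: _ => [|_ _ [y <-] [y' <-]|x _]; first by exists 0; rewrite raddf0.
  by exists (y + y'); rewrite raddfD.
have [|m' <-] := if_exact (m := tcoord x z).
  by rewrite -tmapl_coord z0 raddf0.
by exists (tens m' (fgen R x)); rewrite tmaplE.
Qed.

Variables (X : nat -> choiceType).
Variable d : forall n, {linear freemod R (X n.+1) -> freemod R (X n)}.
Hypothesis dd : forall n x, d n (d n.+1 x) = 0.

Let tmap_dd (N : lmodType R^c) n z : tmap N (d n) (tmap N (d n.+1) z) = 0.
Proof.
apply: (@tensor_ext _ _ _ _ (tmap N (d n) \o tmap N (d n.+1)) \0) => m p /=.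
by rewrite !tmapE dd tens0r.
Qed.

(** The part of the long exact sequence around the homology of M. A cycle
    becomes a boundary in M''; after correction by a lift of the bounding chain,
    it comes from M', where it is a cycle because i stays injective on free
    modules. *)
Lemma tensor_exact_middle n :
  exact_at (fun m => tmap M' (d m)) n -> exact_at (fun m => tmap M'' (d m)) n ->
  exact_at (fun m => tmap M (d m)) n.
Proof.
move=> ex' ex'' z cz; have [|w'' w''E] := ex'' (tmapl f z).
  by case: n {ex' ex''} z cz => //= n z z0; rewrite -tmapl_tmap z0 raddf0.
have [w wE] := tmapl_surj w''.
have [|z' z'E] := tmapl_free_exact (z := z - tmap M (d n) w).
  by rewrite raddfB /= tmapl_tmap wE w''E subrr.
have [|y yE] := ex' z'; last first.
  by exists (w + tmapl i y); rewrite raddfD /= -tmapl_tmap yE z'E addrC subrK.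
case: n z cz w z' {ex' ex'' wE w''E w''} z'E => //= n z z0 w z' z'E.
by apply: tmapl_free_inj; rewrite tmapl_tmap z'E raddfB /= z0 tmap_dd subrr.
Qed.

End ShortExactTensor.

(** The dual chase; maps into M'' lift to M because the P m are projective. *)
Lemma coexact_middle (R : pzRingType) (M M' M'' : lmodType R)
    (i : {linear M' -> M}) (f : {linear M -> M''})
    (P : nat -> lmodType R) (d : forall n, {linear P n.+1 -> P n}) n :
    injective i -> (forall m, exists n, f n = m) ->
    (forall m, f m = 0 -> exists m', i m' = m) ->
    (forall m, projective (P m)) -> (forall m x, d m (d m.+1 x) = 0) ->
  coexact_at d M' n -> coexact_at d M'' n -> coexact_at d M n.
Proof.
move=> i_inj f_surj ex prP dd ex' ex'' g gd.
have factor m (h : {linear P m -> M}) : (forall x, f (h x) = 0) ->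
    exists h' : {linear P m -> M'}, forall x, i (h' x) = h x.
  move=> fh; apply: (@linear_choice _ _ _ (fun x y => i y = h x)) => [x|].
    exact: ex.
  move=> a x x' y y' z yx yx' zx; apply: i_inj.
  by rewrite (linearP i) zx yx yx' linearP.
have fgd x : (f \o g) (d n x) = 0 by rewrite /= gd raddf0.
case: n g gd fgd ex' ex'' => [|n] g gd fgd ex' ex''.
  have [g' g'E] := factor _ g (ex'' _ fgd).
  by move=> x; rewrite -g'E ex' ?raddf0 // => y; apply: i_inj; rewrite g'E gd raddf0.
have [w'' w''E] := ex'' _ fgd; have [w wE] := prP n _ _ f w'' f_surj.
have [|g' g'E] := factor _ (g \- (w \o d n)).
  by move=> x; rewrite /= raddfB /= wE w''E subrr.
have [|y yE] := ex' g'.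
  by move=> x; apply: i_inj; rewrite g'E /= gd dd !raddf0 addr0.
by exists (w \+ (i \o y)) => x; rewrite /= yE g'E /= addrC subrK.
Qed.

(** Filtrations are read from the top, by successive kernels, so that their
    submodules need not be constructed beforehand. *)
Inductive filtered (R : pzRingType) (C : lmodType R -> Prop) :
    lmodType R -> Prop :=
| FilteredZero (M : lmodType R) of (forall m : M, m = 0) : filtered C M
| FilteredStep (M N : lmodType R) (f : {linear M -> N}) of
    (forall n, exists m, f m = n) & C N & filtered C (kermod f) : filtered C M.

Lemma kermod_exact (R : pzRingType) (M N : lmodType R) (f : {linear M -> N}) m :
  f m = 0 -> exists m' : kermod f, val m' = m.
Proof. by move=> /eqP fm; exists (KerMod (fm : m \in ker_pred f)). Qed.

Lemma filtered_tensor_exact (R : pzRingType) (C : lmodType R^c -> Prop)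
    (X : nat -> choiceType)
    (d : forall n, {linear freemod R (X n.+1) -> freemod R (X n)}) n :
    (forall m x, d m (d m.+1 x) = 0) ->
    (forall N, C N -> exact_at (fun m => tmap N (d m)) n) ->
  forall M, filtered C M -> exact_at (fun m => tmap M (d m)) n.
Proof.
move=> dd Cex M; elim=> {M} [M M0|M N f f_surj CN _ ex].
  move=> x _; exists 0; rewrite raddf0; elim/tensor_ind: x => //.
    by move=> t t' <- <-; rewrite subrr.
  by move=> m p; rewrite (M0 m) tens0l.
apply: (@tensor_exact_middle _ _ _ _ (val : kermod f -> M) f) => //.
- exact: kermod_exact.
- exact: Cex.
Qed.

Lemma filtered_coexact (R : pzRingType) (C : lmodType R -> Prop)
    (P : nat -> lmodType R) (d : forall n, {linear P n.+1 -> P n}) n :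
    (forall m, projective (P m)) -> (forall m x, d m (d m.+1 x) = 0) ->
    (forall N, C N -> coexact_at d N n) ->
  forall M, filtered C M -> coexact_at d M n.
Proof.
move=> prP dd Cex M; elim=> {M} [M M0|M N f f_surj CN _ ex].
  case: n {Cex} => [|n] g _ //; exists \0 => x; exact/esym/M0.
apply: (@coexact_middle _ _ _ _ (val : kermod f -> M) f) => //.
- exact: kermod_exact.
- exact: Cex.
Qed.

(** * Restriction of scalars, and right projectivity of bimodule syzygies *)

Section Restriction.
Variables (R S : pzRingType) (phi : {rmorphism R -> S}).

(** The morphism is a phantom argument that selects the module structure on the
    carrier of V. *)
Definition restrict of {rmorphism R -> S} : lmodType S -> Type := fun V => V.

Section Module.
Variable V : lmodType S.
Local Notation W := (restrict phi V).
HB.instance Definition _ := GRing.Zmodule.copy W V.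

Definition restrict_scale (r : R) (v : W) : W := phi r *: (v : V).

Lemma restrict_scaleA r s v :
  restrict_scale r (restrict_scale s v) = restrict_scale (r * s) v.
Proof. by rewrite /restrict_scale rmorphM scalerA. Qed.

Lemma restrict_scale1 : left_id 1 restrict_scale.
Proof. by move=> v; rewrite /restrict_scale rmorph1 scale1r. Qed.

Lemma restrict_scaleDr : right_distributive restrict_scale +%R.
Proof. by move=> r u v; exact: scalerDr. Qed.

Lemma restrict_scaleDl v : {morph restrict_scale^~ v : r s / r + s}.
Proof. by move=> r s; rewrite /restrict_scale raddfD; exact: scalerDl. Qed.

HB.instance Definition _ := GRing.Zmodule_isLmodule.Build R W
  restrict_scaleA restrict_scale1 restrict_scaleDr restrict_scaleDl.

End Module.

Lemma restrictZ (V : lmodType S) r (v : V) :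
  r *: (v : restrict phi V) = phi r *: v.
Proof. by []. Qed.

Lemma restrict_linear (V W : lmodType S) (f : {linear V -> W}) :
  linear (f : restrict phi V -> restrict phi W).
Proof. by move=> r u v; exact: linearP. Qed.

Definition restrict_map (V W : lmodType S) (f : {linear V -> W}) :
    {linear restrict phi V -> restrict phi W} :=
  bundle (restrict_linear f).

End Restriction.

Lemma projective_retract (R : pzRingType) (P Z : lmodType R)
    (i : {linear Z -> P}) (r : {linear P -> Z}) :
  projective P -> cancel i r -> projective Z.
Proof.
move=> prP ir U V p f ps; have [g gE] := prP _ _ p (f \o r) ps.
by exists (g \o i) => x; rewrite /= gE /= ir.
Qed.

(** Bimodules over A are modules over the enveloping algebra E, and restriction
    along [renv] remembers their right action only. All syzygies of the bimodule
    A are projective as right modules; so the bimodule resolution of A splits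
    as a complex of right modules. *)
Section BimoduleSyzygies.
Variables (k : fieldType) (A : pzAlgType k).
Local Notation E := (env A).

Definition lenv (a : A) : E := envt a 1.
Definition renv (b : A^c) : E := envt 1 (b : A).

Lemma envtBl (a a' b : A) : envt (a - a') b = envt a b - envt a' b.
Proof. by apply/eqP; rewrite eq_sym subr_eq -envtDl subrK. Qed.

Lemma envtBr (a b b' : A) : envt a (b - b') = envt a b - envt a b'.
Proof. by apply/eqP; rewrite eq_sym subr_eq -envtDr subrK. Qed.

Lemma envtM (a b a' b' : A) : envt a b * envt a' b' = envt (a * a') (b' * b).
Proof. exact: env_mulE. Qed.

Lemma lenv_is_zmod_morphism : zmod_morphism lenv.
Proof. by move=> a a'; exact: envtBl. Qed.

Lemma lenv_is_monoid_morphism : monoid_morphism lenv.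
Proof. by split=> // a a'; rewrite /lenv envtM mulr1. Qed.

HB.instance Definition _ := GRing.isZmodMorphism.Build A E lenv
  lenv_is_zmod_morphism.
HB.instance Definition _ := GRing.isMonoidMorphism.Build A E lenv
  lenv_is_monoid_morphism.

Lemma renv_is_zmod_morphism : zmod_morphism renv.
Proof. by move=> b b'; exact: envtBr. Qed.

Lemma renv_is_monoid_morphism : monoid_morphism renv.
Proof. by split=> // b b'; rewrite /renv envtM mulr1. Qed.

HB.instance Definition _ := GRing.isZmodMorphism.Build A^c E renv
  renv_is_zmod_morphism.
HB.instance Definition _ := GRing.isMonoidMorphism.Build A^c E renv
  renv_is_monoid_morphism.

Lemma envt_lr (a b : A) : envt a b = renv b * lenv a.
Proof. by rewrite /renv /lenv envtM !mul1r. Qed.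

Lemma renv_kscalar (c : k) : renv (kscalar c) = lenv (kscalar c).
Proof.
by rewrite /renv /lenv -[LHS]/(envt 1 _) -[kscalar c in LHS]mulr1 -envtZ mul1r.
Qed.

Definition rkscalar (c : k) : A^c := kscalar c.

Lemma rkscalar_is_zmod_morphism : zmod_morphism rkscalar.
Proof. exact: kscalarB. Qed.

Lemma rkscalar_is_monoid_morphism : monoid_morphism rkscalar.
Proof.
have [m1 mM] := kscalarM (s := A); split=> // c d.
by rewrite mulrC; exact: mM.
Qed.

HB.instance Definition _ := GRing.isZmodMorphism.Build k A^c rkscalar
  rkscalar_is_zmod_morphism.
HB.instance Definition _ := GRing.isMonoidMorphism.Build k A^c rkscalar
  rkscalar_is_monoid_morphism.

Local Notation rmodule := (restrict renv).

(** E = A (x) A is free on the right over a basis of its left factor. Without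
    choosing a basis: a right linear map f out of E is determined by the k-linear
    map a |-> f (a (x) 1), and k-linear maps lift along a surjection p because p
    has a k-linear section s. *)
Lemma right_projective_free (X : choiceType) : projective (rmodule (freemod E X)).
Proof.
move=> V W p f ps.
have [s sP] := linear_ginverse (restrict_map rkscalar p).
have {}sP w : p (s w) = w by have [v <-] := ps w; exact: sP.
have sZ c w : s (rkscalar c *: w) = rkscalar c *: s w.
  exact: (linearZZ s c w).
have fZ (b : A^c) u : f (renv b *: u) = b *: f u by exact: (linearZZ f b u).
pose h x (a : A) : V := s (f (lenv a *: fgen E x)).
have hD x : {morph h x : a a' / a + a'}.
  by move=> a a'; rewrite /h raddfD scalerDl (raddfD f) (raddfD s).
have hZ x a c : h x (a * kscalar c) = rkscalar c *: h x a.
  have lE : lenv (a * kscalar c) = renv (rkscalar c) * lenv a.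
    by rewrite [renv _]renv_kscalar -kscalarC rmorphM.
  by rewrite /h lE -scalerA fZ sZ.
have hb x : balanced (fun (a : rmod A) (b : lmod A) => (b : A^c) *: h x a).
  split=> [b a a'|a b b'|c a b]; first by rewrite hD scalerDr.
    exact: scalerDl.
  by rewrite hZ scalerA.
pose H x (c : E) : V :=
  tlift (fun (a : rmod A) (b : lmod A) => (b : A^c) *: h x a) c.
have HB x : zmod_morphism (H x) := tlift_is_zmod_morphism (hb x).
have HE x a b : H x (envt a b) = (b : A^c) *: h x a := tliftE (hb x) a b.
pose g (u : freemod E X) : V := msum H u.
have gB : zmod_morphism g := msum_is_zmod_morphism HB.
have gE c x : g (c *: fgen E x) = H x c.
  by rewrite freescaleU mulr1 [LHS](msumU HB).
pose ga : {additive freemod E X -> V} :=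
  HB.pack g (GRing.isZmodMorphism.Build _ _ g gB).
have g0 : g 0 = 0 := raddf0 ga.
have gD : {morph g : u v / u + v} := raddfD ga.
have gZ b u : g (renv b *: u) = b *: g u.
  elim/freemod_ind: u => [|u v hu hv|c x].
  - by rewrite scaler0 g0 scaler0.
  - by rewrite scalerDr !gD scalerDr hu hv.
  rewrite scalerA !gE; elim/env_ind: c => [|c c' hc hc'|a b'].
  - by rewrite mulr0 -(subrr 0) HB subrr scaler0.
  - by rewrite mulrBr !HB hc hc' scalerBr.
  - by rewrite /renv envtM mul1r !HE scalerA.
have gl : linear (g : rmodule (freemod E X) -> V).
  by move=> b u v; rewrite gD restrictZ; congr (_ + _); exact: gZ.
exists (bundle gl) => u; rewrite -[bundle gl u]/(g u).
elim/freemod_ind: u => [|u v hu hv|c x].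
- by rewrite g0 !raddf0.
- by rewrite gD (raddfD p) (raddfD f); congr (_ + _).
rewrite gE; elim/env_ind: c => [|c c' hc hc'|a b].
- by rewrite -[0 in LHS](subrr 0) HB subrr scale0r !raddf0.
- by rewrite HB scalerBl (raddfB p) (raddfB f); congr (_ - _).
- by rewrite HE (linearZZ p) sP envt_lr -scalerA fZ.
Qed.

Lemma right_projective_regl : projective (rmodule (regl A)).
Proof.
move=> V W p f ps; have [v vE] := ps (f 1).
have gl : linear (fun x : rmodule (regl A) => (x : A^c) *: v).
  move=> b x y; rewrite scalerDl restrictZ; congr (_ + _).
  by rewrite scalerA; congr (_ *: _); rewrite [LHS]regl_scaleE mul1r.
exists (bundle gl) => x; rewrite /= /bundled linearZ /= vE -linearZ restrictZ.
by congr (f _); rewrite [LHS]regl_scaleE !mul1r.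
Qed.

(** The covers are surjective, and Z is projective on the right. *)
Lemma right_section (Z : lmodType E) : projective (rmodule Z) ->
  exists s : {linear rmodule Z -> rmodule (freemod E Z)},
    forall z, Defs.fcover Z (s z) = z.
Proof.
move=> prZ; have [s sP] :=
  prZ _ _ (restrict_map renv (Defs.fcover Z)) idfun (@fcover_surj _ Z).
by exists s.
Qed.

(** With a right linear section s of the cover, u |-> u - s (fcover u) retracts
    the free module onto the next syzygy. *)
Lemma right_retraction (Z : lmodType E) : projective (rmodule Z) ->
  exists r : {linear rmodule (freemod E Z) -> rmodule (kermod (Defs.fcover Z))},
    forall z : kermod (Defs.fcover Z), r (val z) = z.
Proof.
move=> prZ; have [s sP] := right_section prZ.
have [u|a u u' v v' w uv uv' uw|r rP] := @linear_choice _
  (rmodule (freemod E Z)) (rmodule (kermod (Defs.fcover Z)))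
  (fun u z => val (z : kermod (Defs.fcover Z)) = u - s (Defs.fcover Z u)).
- suff uP : u - s (Defs.fcover Z u) \in ker_pred (Defs.fcover Z).
    by exists (KerMod uP).
  by apply/eqP; rewrite raddfB /= sP subrr.
- apply: val_inj; rewrite [LHS]uw.
  rewrite -[RHS]/(renv a *: val (v : kermod (Defs.fcover Z)) +
    val (v' : kermod (Defs.fcover Z))).
  rewrite uv uv'.
  rewrite -[s (Defs.fcover Z (_ + _))]/((s \o restrict_map renv (Defs.fcover Z)) (a *: u + u')).
  by rewrite linearP scalerBr addrACA -opprD.
- exists r => z; apply: val_inj; rewrite rP.
  by have /eqP -> := kermodP z; rewrite raddf0 subr0.
Qed.

Lemma right_projective_syzygy n : projective (rmodule (syzygy (regl A) n)).
Proof.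
elim: n => [|n IH]; first exact: right_projective_regl.
have [r rK] := right_retraction IH.
apply: (@projective_retract _ (rmodule (freemod E (syzygy (regl A) n))) _
  (restrict_map renv (val : kermod (Defs.fcover (syzygy (regl A) n)) -> _)) r) => //.
exact: right_projective_free.
Qed.

End BimoduleSyzygies.

(** * From the bimodule resolution to resolutions of characters *)

(** Let psi be a character of the algebra A. Tensoring a bimodule over A, on the
    right, with the one-dimensional module of character psi is base change along
    the morphism a (x) b |-> a psi(b) from E to A. For the standard resolution
    of the bimodule A this gives a free resolution of charmod psi. *)
Section RightCharacter.
Variables (k : fieldType) (A : pzAlgType k) (psi : {rmorphism A -> k}).
Hypothesis psi_k : forall c : k, psi (kscalar c) = c.
Local Notation E := (env A).

Lemma rchar_balanced :
  balanced (fun (a : rmod A) (b : lmod A) => (a : A) * kscalar (psi b) : A).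
Proof.
split=> [b a a'|a b b'|c a b]; first exact: mulrDl.
  by rewrite raddfD /= kscalarD mulrDr.
change ((a : A) * kscalar c * kscalar (psi b) =
  (a : A) * kscalar (psi (kscalar c * (b : A)))).
by rewrite -mulrA rmorphM /= psi_k (kscalarM (s := A)).2.
Qed.

(** The multiplicativity of [rchar] depends on [psi_k], which is therefore
    made an argument. *)
Definition rchar (t : E) : A :=
  let _ := psi_k in
  tlift (fun (a : rmod A) (b : lmod A) => (a : A) * kscalar (psi b) : A) t.

Lemma rcharE (a b : A) : rchar (envt a b) = a * kscalar (psi b).
Proof. exact: tliftE rchar_balanced a b. Qed.

Lemma rchar_is_zmod_morphism : zmod_morphism rchar.
Proof. exact: tlift_is_zmod_morphism rchar_balanced. Qed.

HB.instance Definition _ := GRing.isZmodMorphism.Build E A rchar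
  rchar_is_zmod_morphism.

Lemma rchar_is_monoid_morphism : monoid_morphism rchar.
Proof.
have [k1 kM] := kscalarM (s := A).
split=> [|s t]; first by rewrite [LHS]rcharE rmorph1 k1 mulr1.
elim/env_ind: s => [|s s' hs hs'|a b]; first by rewrite mul0r raddf0 mul0r.
  by rewrite mulrBl !raddfB /= hs hs' mulrBl.
elim/env_ind: t => [|t t' ht ht'|a' b']; first by rewrite mulr0 raddf0 mulr0.
  by rewrite mulrBr !raddfB /= ht ht' mulrBr.
rewrite envtM !rcharE rmorphM mulrC kM -!mulrA; congr (_ * _).
by rewrite !mulrA kscalarC.
Qed.

HB.instance Definition _ := GRing.isMonoidMorphism.Build E A rchar
  rchar_is_monoid_morphism.

Lemma rchar_lenv a : rchar (lenv a) = a.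
Proof. by rewrite [LHS]rcharE rmorph1 (kscalarM (s := A)).1 mulr1. Qed.

Lemma rchar_renv (b : A^c) : rchar (renv b) = kscalar (psi (b : A)).
Proof. by rewrite [LHS]rcharE mul1r. Qed.

Local Notation rmodule := (restrict (@renv k A)).
Local Notation bc := (bchange rchar).

Lemma bchange_rchar_surj (X : choiceType) (v : freemod A X) : exists u, bc u = v.
Proof. by apply: bchange_surj => a; exists (lenv a); exact: rchar_lenv. Qed.

(** The kernel of this base change consists of the combinations of elements
    u b with psi(b) = 0: modulo these, (a (x) b) e is (a psi(b) (x) 1) e. Right
    linear maps preserve them. *)
Lemma right_linear_ker (X Y : choiceType)
    (h : {linear rmodule (freemod E X) -> rmodule (freemod E Y)}) u :
  bc u = 0 -> bc (h u) = 0.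
Proof.
move=> u0.
have hZ (b : A^c) v : h (renv b *: v) = renv b *: h v by exact: (linearZZ h b v).
(* A section of bc is the base change along lenv; D measures the failure of
   h to depend on bc u only, and vanishes on generators. *)
pose D u := bc (h (u - bchange (@lenv k A) (bc u))).
have DB : zmod_morphism D.
  move=> v w; rewrite /D -!raddfB /=; congr (bc (h _)).
  rewrite [bc (v - w)]raddfB /= [bchange _ (_ - _)]raddfB /=.
  by rewrite !opprD !opprK addrACA.
have D0 : D 0 = 0 by rewrite -(subrr 0) DB subrr.
suff : D u = 0 by rewrite /D u0 raddf0 subr0.
elim/freemod_ind: {u0} u => [//|u v hu hv|c x].
  by rewrite -[v]opprK DB hu -[- v]sub0r DB hv D0 !subrr.
elim/env_ind: c => [|c c' hc hc'|a b]; first by rewrite scale0r.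
  by rewrite scalerBl DB hc hc' subrr.
have -> : D (envt a b *: fgen E x) =
    bc (h ((renv b - renv (kscalar (psi b))) *: (lenv a *: fgen E x))).
  rewrite /D !bchange_genZ /= rcharE rmorphM /= -renv_kscalar; congr (bc (h _)).
  rewrite scalerBl !scalerA -envt_lr.
  have -> // : lenv a * renv (kscalar (psi b)) = renv (kscalar (psi b)) * lenv a.
  by rewrite /renv /lenv !envtM !mulr1 !mul1r.
by rewrite -raddfB hZ bchangeZ !raddfB /= !rchar_renv psi_k subrr scale0r.
Qed.

Local Notation Z := (syzygy (regl A)).
Local Notation P n := (freemod E (Z n)).
Local Notation B n := (freemod A (Z n)).

Definition rres_d n : {linear B n.+1 -> B n} := bchange_map rchar (std_d (regl A) n).

Definition rres_aug : {linear B 0 -> charmod psi} :=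
  flift (fun x : regl A => psi x : charmod psi).

Lemma rres_augE u : rres_aug (bc u) = psi (Defs.fcover (regl A) u) :> k.
Proof.
elim/freemod_ind: u => [|u v hu hv|c x]; first by rewrite !raddf0.
  by rewrite !raddfD /= -hu -hv.
rewrite bchange_genZ (linearZZ rres_aug) (linearZZ (Defs.fcover _)).
rewrite [rres_aug _]fliftE [Defs.fcover _ _]fliftE /=.
rewrite -[LHS]/(psi (rchar c) * psi x).
elim/env_ind: c => [|c c' hc hc'|a b].
- by rewrite scale0r !raddf0 mul0r.
- by rewrite scalerBl !raddfB /= mulrBl hc hc'.
- rewrite rcharE [envt a b *: x]regl_scaleE !rmorphM /= psi_k.
  by rewrite mulrAC.
Qed.

Lemma rres_dE n u : rres_d n (bc u) = bc (std_d (regl A) n u).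
Proof. exact: bchange_mapE. Qed.

Lemma rres_surj m : exists x, rres_aug x = m.
Proof.
exists (bc (fgen E (kscalar m : regl A))).
by rewrite [LHS]rres_augE [Defs.fcover _ _]fliftE psi_k.
Qed.

(** Let u be a lift of x, so that psi kills its image l in A. With a right
    linear section s of the augmentation, u - s l is a boundary, and
    s l = (s 1) l disappears under base change because psi(l) = 0. *)
Lemma rres_exact0 x : rres_aug x = 0 <-> exists y, rres_d 0 y = x.
Proof.
split=> [|[y <-]]; last first.
  have [u <-] := bchange_rchar_surj y; rewrite rres_dE [LHS]rres_augE.
  have -> : Defs.fcover (regl A) (std_d (regl A) 0 u) = 0.
    by apply/std_exact0; exists u.
  exact: raddf0.
have [u <-] := bchange_rchar_surj x; rewrite [LHS]rres_augE => u0.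
have [s sP] := right_section (@right_projective_regl k A).
have [|v vE] := (std_exact0 (u - s (Defs.fcover (regl A) u))).1.
  by rewrite raddfB /= sP subrr.
exists (bc v); rewrite rres_dE vE raddfB /=.
have sl (l : A) : s (l : regl A) = renv l *: (s (1 : regl A) : freemod E (regl A)).
  rewrite -[RHS](linearZZ s (l : A^c)); congr (s _).
  by rewrite [RHS]regl_scaleE !mul1r.
by rewrite sl bchangeZ /= rchar_renv u0 -(subrr 0) kscalarB subrr scale0r subr0.
Qed.

(** As in degree 0: u minus s (fcover u) is a boundary, where s is a right
    linear section of the cover of the syzygy. To see that s (fcover u) vanishes
    under base change, s is extended along the retraction r to a right linear
    map of free modules and applied to the boundary of u. *)
Lemma rres_exactS n x : rres_d n x = 0 <-> exists y, rres_d n.+1 y = x.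
Proof.
split=> [|[y <-]]; last first.
  have [u <-] := bchange_rchar_surj y; rewrite !rres_dE.
  have -> : std_d (regl A) n (std_d (regl A) n.+1 u) = 0.
    by apply/std_exactS; exists u.
  exact: raddf0.
have [u <-] := bchange_rchar_surj x; rewrite rres_dE => du0.
have [s sP] := right_section (@right_projective_syzygy k A n.+1).
have [r rP] := right_retraction (@right_projective_syzygy k A n).
have [|v vE] := (std_exactS (u - s (Defs.fcover (Z n.+1) u))).1.
  have F0 : Defs.fcover (Z n.+1) (u - s (Defs.fcover (Z n.+1) u)) = 0.
    by rewrite raddfB /= sP subrr.
  exact: (congr1 val F0).
exists (bc v); rewrite rres_dE vE raddfB /=.
rewrite -[Defs.fcover (Z n.+1) u]rP.
have -> : bc (s (r (std_d (regl A) n u))) = 0.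
  exact: (right_linear_ker (s \o r : {linear _ -> _}) du0).
exact: subr0.
Qed.

Definition rres : resolution (charmod psi) :=
  @Resolution A (charmod psi) (fun n => B n) rres_d rres_aug
    (fun n => @free_projective A (Z n)) rres_surj rres_exact0 rres_exactS.

End RightCharacter.

Section BimoduleCharacter.
Variables (k : fieldType) (A : pzAlgType k).
Variables (chi psi : {rmorphism A -> k}).
Hypothesis psi_k : forall c : k, psi (kscalar c) = c.

(** The character by which a (x) b acts on a simple bimodule with left character
    chi and right character psi. *)
Definition bichar : {rmorphism env A -> k} := chi \o rchar psi_k.

Lemma bicharE (a b : A) : (forall c : k, chi (kscalar c) = c) ->
  bichar (envt a b) = chi a * psi b.
Proof. by move=> chi_k; rewrite /bichar /= rcharE rmorphM /= chi_k. Qed.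

Variables (M : lmodType A^c) (th : {additive M -> k}) (th' : {additive k -> M}).
Hypotheses (thK : cancel th th') (thK' : cancel th' th).
Hypothesis thZ : forall (a : A) m, th ((a : A^c) *: m) = th m * chi a.
Variables (N : lmodType A) (f : {linear charmod psi -> N}) (g : N -> charmod psi).
Hypotheses (fK : cancel f g) (gK : cancel g f).

(** This is the isomorphism between Tor over E of a simple bimodule with A and
    Tor over A of two simple modules, restricted to what vanishing requires. The
    standard resolution of N is compared with [rres]; tensoring the latter with
    M is base change along chi, and the two successive base changes combine into
    the one along [bichar]. *)
Lemma Tor_bichar_exact n : (forall v : Tor n M N, v = 0) ->
  exact_at (fun m => bchange_map bichar (std_d (regl A) m)) n.
Proof.
pose Q := transport_resolution (rres psi_k) fK gK.
move=> /Tor_res_eq0 /(@Tor_res_comparison _ _ _ _ Q).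
move=> /(tensor_charmod_exact thK thK' thZ).
by apply: eq_exact_at => m; exact: bchange_map_comp.
Qed.

End BimoduleCharacter.

(** * Flags of one-dimensional subquotients *)

Section Span.
Variables (k : fieldType) (V : lmodType k).

(** The span, with one coefficient for each entry, in the form that an induction
    on the list consumes. *)
Fixpoint kspan (s : seq V) (v : V) : Prop :=
  if s is u :: s' then exists c, kspan s' (v - c *: u) else v = 0.

Lemma kspan_cons u s v : kspan s v -> kspan (u :: s) v.
Proof. by move=> sv; exists 0; rewrite scale0r subr0. Qed.

Lemma kspan0 s : kspan s 0.
Proof. by elim: s => //= u s IH; exact: kspan_cons. Qed.

Lemma kspan_lin s a v w : kspan s v -> kspan s w -> kspan s (a *: v + w).
Proof.
elim: s v w => [|u s IH] v w /=; first by move=> -> ->; rewrite scaler0 addr0.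
move=> [c sv] [d sw]; exists (a * c + d).
by rewrite scalerDl -scalerA opprD addrACA -scalerBr; exact: IH.
Qed.

Lemma kspanZ s a v : kspan s v -> kspan s (a *: v).
Proof. by move=> sv; rewrite -[_ *: _]addr0; apply: kspan_lin (kspan0 _). Qed.

Lemma kspanD s v w : kspan s v -> kspan s w -> kspan s (v + w).
Proof. by move=> sv sw; rewrite -[v]scale1r; exact: kspan_lin. Qed.

Lemma kspanB s v w : kspan s v -> kspan s w -> kspan s (v - w).
Proof. by move=> sv sw; rewrite addrC -scaleN1r; exact: kspan_lin. Qed.

Lemma kspan_mem s v : v \in s -> kspan s v.
Proof.
elim: s => //= u s IH; rewrite inE => /predU1P[->|/IH]; last exact: kspan_cons.
by exists 1; rewrite scale1r subrr; exact: kspan0.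
Qed.

Lemma kspan_cat s t v : kspan t v -> kspan (s ++ t) v.
Proof. by move=> tv; elim: s => //= u s IH; exact: kspan_cons. Qed.

Lemma kspan_unscale s c v : c != 0 -> kspan s (c *: v) -> kspan s v.
Proof. by move=> c0 /(kspanZ c^-1); rewrite scalerA mulVf // scale1r. Qed.

End Span.

Lemma kspan_map (k : fieldType) (V W : lmodType k) (f : {linear V -> W}) s v :
  kspan s v -> kspan (map f s) (f v).
Proof.
elim: s v => [|u s IH] v /=; first by move=> ->; rewrite raddf0.
by move=> [c /IH sv]; exists c; rewrite -linearZ -raddfB.
Qed.

Section Flag.
Variables (R : pzRingType) (k : fieldType) (kk : {rmorphism k -> R}).
Variable L : lmodType R.
Local Notation V := (restrict kk L).
Variable C : {rmorphism R -> k} -> Prop.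

(** The k-structure of L comes from kk, and L is handled as the vector space V;
    [act] is what remains of the action of R on V. *)
Definition act (r : R) (v : V) : V := r *: (v : L).

Lemma act_lin r c (u v : V) : act r (c *: u + v) = act (r * kk c) u + act r v.
Proof. by rewrite [LHS]scalerDr [in LHS]scalerA. Qed.

Lemma act0 r : act r 0 = 0.
Proof. exact: (@scaler0 _ L). Qed.

Lemma act_char0 (chi : {rmorphism R -> k}) v : act 0 v - chi 0 *: v = 0.
Proof. by rewrite /act raddf0 !scale0r subr0. Qed.

Lemma act_charB (chi : {rmorphism R -> k}) r s v :
  act (r - s) v - chi (r - s) *: v =
  -1 *: (act s v - chi s *: v) + (act r v - chi r *: v).
Proof.
have -> : act (r - s) v = act r v - act s v by exact: (@scalerBl _ L).
by rewrite scaleN1r [RHS]addrC raddfB scalerBl /= opprD addrACA -opprD.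
Qed.

(** The entries of a flag are taken from the top of a filtration down: R acts on
    each vector by its character modulo the span of the later ones. A vector may
    already lie in that span, and then its character is not a subquotient; only
    the others have to satisfy C. *)
Fixpoint flag (s : seq (V * {rmorphism R -> k})) : Prop :=
  if s is (v, chi) :: s' then
    [/\ flag s',
        forall r : R, kspan (unzip1 s') (act r v - chi r *: v),
        forall c : k, chi (kk c) = c
      & ~ kspan (unzip1 s') v -> C chi]
  else True.

Lemma flag_stable s (r : R) (v : V) : flag s ->
  kspan (unzip1 s) v -> kspan (unzip1 s) (act r v).
Proof.
elim: s v => [|[u chi] s IH] v /=; first by move=> _ ->; exact: act0.
case=> fs us chik _ [c sv]; exists (chi (r * kk c)).
have -> : act r v = act (r * kk c) u + act r (v - c *: u).
  by rewrite -act_lin addrC subrK.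
by rewrite addrAC; apply: kspanD => //; exact: IH.
Qed.

(** By induction on s, for a module M embedded in L with image the span of s. The
    first vector v is either redundant, or its coefficient is a linear map from M
    onto charmod chi whose kernel has the span of the other vectors as its
    image. *)
Lemma flag_filtered s (M : lmodType R) (j : {linear M -> L}) :
    injective j -> flag s ->
    (forall l : L, (exists m, j m = l) <-> kspan (unzip1 s) (l : V)) ->
  filtered (fun N => exists2 chi, C chi & N = charmod chi) M.
Proof.
elim: s M j => [|[v chi] s IH] M j j_inj.
  move=> _ jM; apply: FilteredZero => m; apply: j_inj.
  by rewrite raddf0; apply/jM; exists m.
move=> /= [fs sv chik Cchi] jM.
have [vs|nvs] := pselect (kspan (unzip1 s) v).
  apply: (IH M j) => // l; apply: (iff_trans (jM l)); split=> [[c sl]|sl].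
    by rewrite -[l : V](subrK (c *: v : V)); apply: kspanD => //; exact: kspanZ.
  exact: (@kspan_cons _ V).
have v0 c : kspan (unzip1 s) (c *: v) -> c = 0.
  by move=> cv; apply/eqP/negPn/negP => c0; apply: nvs; exact: kspan_unscale cv.
pose rel (m : M) (c : charmod chi) := kspan (unzip1 s) ((j m : V) - (c : k) *: v).
have [m|a m m' c c' d mc m'c' md|f fP] := @linear_choice _ M (charmod chi) rel.
- by have [c cP] := (jM (j m)).1 (ex_intro _ m erefl); exists c.
- have amc := flag_stable a fs mc.
  have jmE : act a (j m) = act (a * kk c) v + act a ((j m : V) - (c : k) *: v).
    by rewrite -act_lin addrC subrK.
  have jE : (j (a *: m + m') : V) = act a (j m) + (j m' : V) by exact: linearP.
  apply/eqP; rewrite -subr_eq0; apply/eqP/v0.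
  have := kspanB (kspanD (kspanD (sv (a * kk c)) amc) m'c') md.
  congr (kspan _ _); rewrite [X in X + _ - _]addrAC -jmE.
  rewrite [X in X - _]addrACA -jE rmorphM chik.
  by rewrite -opprD -scalerDl opprB [LHS]addrC addrA subrK -scalerBl.
- have fU m c : rel m c -> f m = c.
    move=> mc; apply/eqP; rewrite -subr_eq0; apply/eqP/v0.
    have := kspanB mc (fP m); congr (kspan _ _).
    by rewrite opprB [LHS]addrC addrA subrK -scalerBl.
  apply: (@FilteredStep _ _ _ (charmod chi) f) => [c||].
  + have [|m mE] := (jM ((c : k) *: v)).2.
      by exists c; rewrite subrr; exact: kspan0.
    by exists m; apply: fU; rewrite /rel mE subrr; exact: kspan0.
  + by exists chi => //; exact: Cchi.
  apply: (IH _ (j \o (val : kermod f -> M))) => //.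
    by move=> x y /j_inj /val_inj.
  move=> l; split=> [[m <-]|sl].
    have := fP (val m); rewrite /rel (eqP (kermodP m)) scale0r subr0.
    exact.
  have [m mE] := (jM l).2 (@kspan_cons _ V v _ l sl).
  have m0 : f m = 0 by apply: fU; rewrite /rel scale0r subr0 mE.
  have [m' m'E] := kermod_exact m0.
  by exists m'; rewrite /= [val m']m'E.
Qed.

End Flag.

(** * Paths in a bound quiver algebra *)

Section BoundQuiver.
Variables (k : fieldType) (Q : quiver) (I : admissible_ideal k Q).
Local Notation A := (bqa I).
Local Notation pterm := (@pterm k Q).
Local Notation qpi := (quot_pi I).

Section VertexCharacter.
Variable x : vertex Q.

Lemma chi_is_zmod_morphism : zmod_morphism (@chi k Q I x).
Proof.
elim/quot_ind => u; elim/quot_ind => v.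
by rewrite -[qpi u - _](raddfB qpi) !chiE tcoefB.
Qed.

Lemma chi_is_monoid_morphism : monoid_morphism (@chi k Q I x).
Proof. by split; [exact: chi1|exact: chiM]. Qed.

HB.instance Definition _ := GRing.isZmodMorphism.Build A k (@chi k Q I x)
  chi_is_zmod_morphism.
HB.instance Definition _ := GRing.isMonoidMorphism.Build A k (@chi k Q I x)
  chi_is_monoid_morphism.

Definition vchar : {rmorphism A -> k} := @chi k Q I x.

Lemma vcharE u : vchar (qpi u) = tcoef x u.
Proof. exact: chiE. Qed.

Lemma tcoefZ c (u : pathalg k Q) : tcoef x (c *: u) = c * tcoef x u.
Proof. exact: freescaleE. Qed.

Lemma vchar_kscalar (c : k) : vchar (kscalar c) = c.
Proof. by rewrite [LHS]vcharE tcoefZ tcoef1 mulr1. Qed.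

End VertexCharacter.

Lemma qpiZ c u : qpi (c *: u) = c *: (qpi u : lmod A) :> lmod A.
Proof.
rewrite -[RHS]/(qpi (kscalar c) * qpi u) -quot_piM; congr (qpi _).
by rewrite -[RHS]pa_scaleAl mul1r.
Qed.

Definition pclass (p : qpath Q) : lmod A := qpi (pterm 1 p).

Definition plength (p : qpath Q) : nat := size (parr p).

Lemma plength0 p : plength p = 0%N -> p = triv (pstart p).
Proof. by case: p => [[x [|a s]] ps] // _; apply: val_inj. Qed.

(** A path is its last arrow composed with a shorter path. *)
Lemma long_path_ideal n (p : qpath Q) : (n <= plength p)%N ->
  ideal_exp (@arrow_ideal k Q) n (pterm 1 p).
Proof.
elim: n p => [//|n IH] [[x s] ps] /= np.
case/lastP: s ps np => [//|s a] ps np.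
have /andP[sP /andP[/eqP aE _]] :
    is_path x s && is_path (path_end x s) [:: a] by rewrite -is_path_cat cats1.
pose q : qpath Q := @QPath Q (x, s) sP.
have -> : pterm 1 (QPath ps) = pterm 1 (arrow_path a) * pterm 1 q.
  rewrite ptermE mulr1; case: pcompP => [r _ rE|[]] /=; last first.
    exact/esym.
  by congr (pterm _ _); apply: val_inj; rewrite rE /= cats1.
apply: mem_zgen; exists (pterm 1 (arrow_path a)).
  by move=> J _; apply; exists a.
exists (pterm 1 q) => //; apply: IH.
by move: np; rewrite /plength /= size_rcons ltnS.
Qed.

Lemma long_path0 : exists m, forall p, (m <= plength p)%N -> pclass p = 0.
Proof.
have [m _ [mI _]] := admP I; exists m => p mp.
rewrite -[RHS](raddf0 qpi); apply/quot_piP; rewrite subr0.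
by apply: mI; exact: long_path_ideal.
Qed.

(** In a product q p q' of paths, either q and q' are the trivial paths at the
    ends of p, which gives p, or the product is 0 or a longer path. The first
    case is the one that the characters at the two ends detect. *)
Lemma pclass_triangular (U : set (lmod A)) (p : qpath Q) :
    U 0 -> (forall c u v, U u -> U v -> U (c *: u + v)) ->
    (forall q, (plength p < plength q)%N -> U (pclass q)) ->
  forall a b : A, U ((a * (pclass p : A) * b : lmod A) -
    (vchar (pend p) a * vchar (pstart p) b) *: pclass p).
Proof.
move=> U0 UL Up; elim/quot_ind => u; elim/quot_ind => w.
rewrite !vcharE -[X in X - _]/((qpi u * qpi (pterm 1 p)) * qpi w) -!quot_piM.
have UD v v' : U v -> U v' -> U (v + v').
  by move=> Uv Uv'; rewrite -[v]scale1r; exact: UL.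
elim/pa_ind: u => [|u u' hu hu'|c q].
- by rewrite !mul0r raddf0 tcoef0 mul0r scale0r subr0.
- rewrite !mulrDl raddfD tcoefD mulrDl scalerDl opprD /= addrACA.
  exact: UD.
elim/pa_ind: w => [|w w' hw hw'|d q'].
- by rewrite !mulr0 raddf0 tcoef0 mulr0 scale0r subr0.
- rewrite !mulrDr raddfD tcoefD mulrDr scalerDl opprD /= addrACA.
  exact: UD.
rewrite !tcoefU.
have -> : c *+ (q == triv (pend p)) * (d *+ (q' == triv (pstart p))) =
    (c * d) *+ ((q == triv (pend p)) && (q' == triv (pstart p))).
  by rewrite mulrnAl mulrnAr -mulrnA mulnC mulnb.
have [/andP[/eqP -> /eqP ->]|nt] := boolP (_ && _).
  rewrite ptermE pcomp1p /= ptermE pcompp1 /= !mulr1 -[c * d]mulr1 -ptermZ.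
  by rewrite qpiZ mulr1 subrr.
rewrite mulr0n scale0r subr0 ptermE; case: pcompP => [r e rE|_] /=; last first.
  by rewrite mul0r raddf0.
rewrite ptermE; case: pcompP => [t e' tE|_] /=; last by rewrite raddf0.
rewrite -[_ * d]mulr1 -ptermZ qpiZ -[_ *: _]addr0; apply: UL => //; apply: Up.
have -> : plength t = (plength q' + (plength p + plength q))%N.
  by rewrite {1}/plength /parr tE /= size_cat /parr rE /= size_cat.
rewrite addnCA -addn1 leq_add2l lt0n addn_eq0.
apply: contra nt => /andP[/eqP q'0 /eqP q0].
apply/andP; split; apply/eqP.
  by rewrite (plength0 q0) e.
have q'E := plength0 q'0; rewrite q'E; congr triv.
by have := e'; rewrite q'E /pstart rE.
Qed.

Definition paths_of_length (n : nat) : seq (qpath Q) :=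
  pmap insub [seq (x, val s) | x <- enum (vertex Q),
                               s <- enum {: n.-tuple (arrow Q)}].

Lemma mem_paths_of_length n p : p \in paths_of_length n = (plength p == n).
Proof.
rewrite mem_pmap_sub; apply/allpairsP/eqP => [[[x s] [_ _ /= pE]]|pn].
  by rewrite /plength /parr /= pE size_tuple.
exists (pstart p, tcast pn (in_tuple (parr p))); split; rewrite ?mem_enum //=.
by rewrite val_tcast; case: (p) => [[]].
Qed.

Fixpoint paths_from (l n : nat) : seq (qpath Q) :=
  if n is n'.+1 then paths_of_length l ++ paths_from l.+1 n' else [::].

(** The list ends at length l + n, beyond which the classes are zero. *)
Lemma kspan_paths_from l n :
    (forall p, (l + n <= plength p)%N -> pclass p = 0) ->
  forall p, (l <= plength p)%N -> kspan (map pclass (paths_from l n)) (pclass p).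
Proof.
elim: n l => [|n IH] l long p lp; first by apply: long; rewrite addn0.
rewrite /= map_cat; case: (ltnP l (plength p)) => [lt|le].
  by apply: kspan_cat; apply: IH => // q; rewrite addSnnS; exact: long.
apply: kspan_mem; rewrite mem_cat map_f // mem_paths_of_length.
by rewrite eqn_leq le.
Qed.

Lemma kspan_all_paths m : (forall p, (m <= plength p)%N -> pclass p = 0) ->
  forall a : lmod A, kspan (map pclass (paths_from 0 m)) a.
Proof.
move=> long; elim/quot_ind; elim/pa_ind => [|u v hu hv|c p].
- by rewrite raddf0; exact: kspan0.
- by rewrite raddfD; exact: kspanD.
- rewrite -[c]mulr1 -ptermZ qpiZ; apply: kspanZ; exact: kspan_paths_from.
Qed.

Lemma pclass_corner s p :
  ~ kspan s (pclass p) -> corner_neq0 I (pend p) (pstart p).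
Proof.
move=> ps; exists (pclass p : A).
have -> : idem I (pend p) * (pclass p : A) * idem I (pstart p) = pclass p.
  rewrite -[LHS]/(qpi (pterm 1 _) * qpi (pterm 1 p) * qpi (pterm 1 _)).
  by rewrite -!quot_piM ptermE pcomp1p /= ptermE pcompp1 /= !mulr1.
by apply/eqP => p0; apply: ps; rewrite p0; exact: kspan0.
Qed.

(** The left and the right module A over the enveloping algebra have the same
    flag of paths; L stands for either of them, and X p for the character
    of the subquotient spanned by p. *)
Section PathFlag.
Variables (R : pzRingType) (kk : {rmorphism k -> R}) (L : lmodType R).
Variable e : {linear lmod A -> restrict kk L}.
Variable X : qpath Q -> {rmorphism R -> k}.
Hypothesis Xkk : forall p c, X p (kk c) = c.
(* The set U plays the part of the span of the longer paths. *)
Hypothesis eX : forall (p : qpath Q) (r : R) (U : set (restrict kk L)),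
  U 0 -> (forall c u v, U u -> U v -> U (c *: u + v)) ->
  (forall q, (plength p < plength q)%N -> U (e (pclass q))) ->
  U (act r (e (pclass p)) - X p r *: e (pclass p)).
Hypothesis e_surj : forall l, exists a, e a = l.

Definition corner_char (chi : {rmorphism R -> k}) : Prop :=
  exists p, corner_neq0 I (pend p) (pstart p) /\ chi = X p.

(** By increasing length, every path is followed in the list by all the longer
    ones with a nonzero class, so [eX] applies to the span of what follows. A
    path outside that span has a nonzero class, hence a nonzero corner at its
    ends. *)
Lemma path_flag l n : (forall p, (l + n <= plength p)%N -> pclass p = 0) ->
  flag corner_char [seq (e (pclass p), X p) | p <- paths_from l n].
Proof.
elim: n l => [//|n IH] l long /=.
have {}long p : (l.+1 + n <= plength p)%N -> pclass p = 0.
  by rewrite addSnnS; exact: long.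
have u1 s : unzip1 [seq (e (pclass p), X p) | p <- s] = map e (map pclass s).
  by rewrite /unzip1 -!map_comp.
have : all (fun p => plength p == l) (paths_of_length l).
  by apply/allP => p; rewrite mem_paths_of_length.
elim: (paths_of_length l) => [_|p s IHs /= /andP[/eqP pl sl]]; first exact: IH.
split; [exact: IHs| |exact: Xkk|] => [r|ps].
  rewrite u1 map_cat map_cat; apply: eX => [|c u v|q lq].
  - exact: kspan0.
  - exact: kspan_lin.
  - apply: kspan_cat; apply: kspan_map; apply: kspan_paths_from => //.
    by rewrite -pl.
exists p; split=> //; apply: (@pclass_corner (map pclass (s ++ paths_from l.+1 n))).
by move=> sp; apply: ps; rewrite u1; exact: kspan_map.
Qed.

Lemma path_filtered :
  filtered (fun N => exists2 chi, corner_char chi & N = charmod chi) L.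
Proof.
have [m long] := long_path0.
apply: (@flag_filtered R k kk L corner_char _ L idfun _
  (@path_flag 0 m long)) => // l.
split=> _; last by exists l.
have [a <-] := e_surj l.
rewrite /unzip1 -map_comp (map_comp e pclass); apply: kspan_map.
exact: kspan_all_paths.
Qed.

End PathFlag.

End BoundQuiver.

(** * The two bimodule structures filtered by paths *)

Section OppositeScalars.
Variables (k : fieldType) (R : pzRingType) (rho : {rmorphism k -> R}).

(** The right module structure of A is a left one over the converse of the
    enveloping algebra, which must also receive the scalars. *)
Definition opscalar (c : k) : R^c := rho c.

Lemma opscalar_is_zmod_morphism : zmod_morphism opscalar.
Proof. by move=> c d; exact: (raddfB rho). Qed.

Lemma opscalar_is_monoid_morphism : monoid_morphism opscalar.
Proof.
split=> [|c d]; first exact: (rmorph1 rho).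
by rewrite /opscalar mulrC; exact: (rmorphM rho).
Qed.

HB.instance Definition _ := GRing.isZmodMorphism.Build k R^c opscalar
  opscalar_is_zmod_morphism.
HB.instance Definition _ := GRing.isMonoidMorphism.Build k R^c opscalar
  opscalar_is_monoid_morphism.

End OppositeScalars.

Section BimoduleFiltration.
Variables (k : fieldType) (Q : quiver) (I : admissible_ideal k Q).
Local Notation A := (bqa I).

Definition pair_char (u v : vertex Q) : {rmorphism env A -> k} :=
  bichar (vchar I u) (vchar_kscalar I v).

Lemma pair_charE u v (a b : A) :
  pair_char u v (envt a b) = vchar I u a * vchar I v b.
Proof. by rewrite [LHS]bicharE //; exact: vchar_kscalar. Qed.

Definition kenv : {rmorphism k -> env A} := @renv k A \o @rkscalar k A.

Lemma kenvE (c : k) : kenv c = envt 1 (kscalar c : A).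
Proof. by []. Qed.

Lemma pair_char_kenv u v c : pair_char u v (kenv c) = c.
Proof. by rewrite kenvE pair_charE rmorph1 mul1r; exact: vchar_kscalar. Qed.

(** Here a (x) b sends p to a p b. *)
Lemma regl_filtered : filtered (fun N => exists2 chi,
  corner_char I (fun p => pair_char (pend p) (pstart p)) chi &
  N = charmod chi) (regl A).
Proof.
have el : linear (fun a : lmod A => a : restrict kenv (regl A)).
  move=> c a b; congr (_ + _).
  by rewrite restrictZ [RHS]regl_scaleE mul1r -kscalarC.
apply: (@path_filtered _ _ I _ kenv (regl A) (bundle el)) => //.
- by move=> p c; exact: pair_char_kenv.
- move=> p r U U0 UL Up; elim/env_ind: r => [|t t' ht ht'|a b].
  + by rewrite act_char0.
  + by rewrite act_charB; exact: UL ht' ht.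
  + rewrite pair_charE /act [envt a b *: _]regl_scaleE -linearZ.
    rewrite -[X in U (X - _)]/(bundle el _) -raddfB.
    apply: (@pclass_triangular _ _ I (fun l => U (bundle el l))) => // c u v Uu Uv.
    by rewrite linearP; exact: UL.
- by move=> l; exists l.
Qed.

Definition kopenv : {rmorphism k -> (env A)^c} := @opscalar k (env A) kenv.

(** Here a (x) b sends p to b p a, so the two ends of p change places. *)
Lemma regr_filtered : filtered (fun N => exists2 chi,
  corner_char I (fun p =>
    opchar (pair_char (pstart p) (pend p)) : {rmorphism (env A)^c -> k}) chi &
  N = charmod chi) (regr A).
Proof.
have el : linear (fun a : lmod A => a : restrict kopenv (regr A)).
  move=> c a b; congr (_ + _).
  by rewrite restrictZ [RHS]regr_scaleE mulr1.
apply: (@path_filtered _ _ I _ kopenv (regr A) (bundle el)) => //.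
- by move=> p c; exact: pair_char_kenv.
- move=> p r U U0 UL Up.
  change (env A) in (type of r).
  elim/env_ind: r => [|t t' ht ht'|a b].
  + by rewrite act_char0.
  + by rewrite act_charB; exact: UL ht' ht.
  + have -> : act (envt a b : (env A)^c) (bundle el (pclass I p)) =
        bundle el ((b : A) * (pclass I p : A) * (a : A) : lmod A).
      exact: regr_scaleE.
    have -> : (opchar (pair_char (pstart p) (pend p)) : {rmorphism (env A)^c -> k})
        (envt a b : (env A)^c) = vchar I (pend p) b * vchar I (pstart p) a.
      by rewrite mulrC; exact: pair_charE.
    rewrite -linearZ -raddfB.
    apply: (@pclass_triangular _ _ I (fun l => U (bundle el l))) => // c u v Uu Uv.
    by rewrite linearP; exact: UL.
- by move=> l; exists l.
Qed.

End BimoduleFiltration.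

(** * Hochschild homology and cohomology *)

(** Were all the W t finite, the finite union of their supports, which
    contains that of V, would be finite. *)
Lemma graded_infinite_pigeonhole (T : finType) (P : T -> Prop)
    (V : nat -> zmodType) (W : T -> nat -> zmodType) :
    (forall n, (forall t, P t -> forall w : W t n, w = 0) ->
      forall v : V n, v = 0) ->
    graded_infinite V ->
  exists t, P t /\ graded_infinite (W t).
Proof.
move=> VW Vinf; apply: contrapT => fin; apply: Vinf.
apply: (@sub_finite_set _ _
  (\bigcup_(t in [set t | P t]) [set n | exists w : W t n, w != 0])).
  move=> n [v v0]; apply: contrapT => nW; move/eqP: v0; apply.
  apply: VW => t Pt w; apply: contrapT => /eqP w0.
  by apply: nW; exists t => //; exists w.
apply: bigcup_finite => [|t Pt]; first exact: finite_finset.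
by apply: contrapT => Winf; apply: fin; exists t.
Qed.

Section Vanishing.
Variables (k : fieldType) (Q : quiver) (I : admissible_ideal k Q) (n : nat).
Local Notation A := (bqa I).
Local Notation d := (std_d (regl A)).

Lemma std_dd (R : pzRingType) (M : lmodType R) m x :
  std_d M m (std_d M m.+1 x) = 0.
Proof. by apply/std_exactS; exists x. Qed.

Lemma Tor_simple_exact (u v : vertex Q) :
    (forall t : Tor_simple I u v n, t = 0) ->
  exact_at (fun m => bchange_map (pair_char I u v) (d m)) n.
Proof.
have fl : linear (fun c : charmod (vchar I v) => c : simple_left I v) by [].
apply: (@Tor_bichar_exact k A (vchar I u) (vchar I v) (vchar_kscalar I v)
  (simple_right I u) (idfun : {additive k -> k}) (idfun : {additive k -> k})
  _ _ _ (simple_left I v) (bundle fl) idfun) => //.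
Qed.

(** The subquotients of the coefficients A are the simple bimodules at the nonzero
    corners; if their Tor with A vanishes in degree n, so does that of A. *)
Lemma HH_homology_eq0 :
    (forall y x, corner_neq0 I y x -> forall t : Tor_simple I x y n, t = 0) ->
  forall t : HH_homology A n, t = 0.
Proof.
move=> Tor0; apply/(@Tor_res_eq0 _ (regr A) _ (std_res (regl A))).
apply: (filtered_tensor_exact _ _ (regr_filtered I)) => [m x|N].
  exact: std_dd.
case=> _ [p [yx ->]] ->.
exact/tensor_opchar_exact/Tor_simple_exact/Tor0.
Qed.

(** The same filtration, for the coefficients of Ext: each subquotient
    contributes the dual of a Tor between simple modules, at the corner with its
    two ends in the other order. *)
Lemma HH_cohomology_eq0 :
    (forall y x, corner_neq0 I y x -> forall t : Tor_simple I y x n, t = 0) ->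
  forall t : HH_cohomology A n, t = 0.
Proof.
move=> Tor0; apply: (@Ext_res_eq0 _ _ (regl A) (std_res (regl A))).
apply: (filtered_coexact _ _ _ (regl_filtered I)) => [m|m x|N].
- exact: free_projective.
- exact: std_dd.
case=> _ [p [yx ->]] ->; apply: hom_charmod_exact.
- by move=> c; exists (kenv I c); exact: pair_char_kenv.
- exact/Tor_simple_exact/Tor0.
Qed.

End Vanishing.

Theorem theorem5p6 (k : fieldType) (Q : quiver) (I : admissible_ideal k Q) :
  infinite_gldim (bqa I) ->
  (positive_answer_Han (bqa I) -> infinite_plus_gldim I) /\
  (positive_answer_Happel (bqa I) -> infinite_coplus_gldim I).
Proof.
move=> _; split=> -[_ HHinf].
  have [n Tor0|[y x] [/= yx Tinf]] := @graded_infinite_pigeonhole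
      (vertex Q * vertex Q)%type (fun t => corner_neq0 I t.1 t.2) _
      (fun t => Tor_simple I t.2 t.1) _ HHinf; last by exists y, x.
  by apply: HH_homology_eq0 => y x yx; exact: (Tor0 (y, x)).
have [n Tor0|[y x] [/= yx Tinf]] := @graded_infinite_pigeonhole
    (vertex Q * vertex Q)%type (fun t => corner_neq0 I t.1 t.2) _
    (fun t => Tor_simple I t.1 t.2) _ HHinf; last by exists y, x.
by apply: HH_cohomology_eq0 => y x yx; exact: (Tor0 (y, x)).
Qed.
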